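(* Let $\varphi$ and $\omega$ be Schwarz-type functions, let $F=\ell\circ\omega$, and suppose $T_{F,\varphi}(f)\in\mathcal{P}$ for every $f\in\mathcal{P}$ and that $\varphi$ is not a rotation. Then $T_{F,\varphi}$ has a unique fixed point $G$ in $\mathcal{P}$, and for every $f\in\mathcal{P}$ the iterates $T_{F,\varphi}^n f$ converge to $G$ uniformly on compact subsets of $\mathbb{D}$ as $n\to\infty$. If moreover $\varphi$ is inner (and not a rotation), this unique fixed point is the constant function $1$.
   Context: $\mathbb{D}$ is the open unit disk. $\mathcal{P}$ is the set of analytic $f$ on $\mathbb{D}$ with $\mathrm{Re}\,f>0$ and $f(0)=1$. A Schwarz-type function is an analytic $\varphi:\mathbb{D}\to\mathbb{D}$ with $\varphi(0)=0$. A rotation is a map $z\mapsto\lambda z$ with $|\lambda|=1$. $\ell(z)=\frac{1+z}{1-z}$. $T_{F,\varphi}(f)=F\cdot(f\circ\varphi)$, and $T^n_{F,\varphi}$ is its $n$-th iterate. An inner function is a bounded analytic function on $\mathbb{D}$ with $|\varphi|\le1$ whose radial limits have modulus one almost everywhere on the unit circle. *)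

(* Defs.v *)
From Stdlib Require Import Reals List.
From Coquelicot Require Import Coquelicot.
Open Scope R_scope.

Definition inD (z : C) : Prop := Cmod z < 1.

Definition analytic_on_D (f : C -> C) : Prop :=
  forall z : C, inD z -> @ex_derive C_AbsRing C_NormedModule f z.

Definition inP (f : C -> C) : Prop :=
  analytic_on_D f /\ (forall z, inD z -> 0 < Re (f z)) /\ f (RtoC 0) = RtoC 1.

Definition schwarz_type (phi : C -> C) : Prop :=
  analytic_on_D phi /\ (forall z, inD z -> inD (phi z)) /\ phi (RtoC 0) = RtoC 0.

Definition is_rotation (phi : C -> C) : Prop :=
  exists lam : C, Cmod lam = 1 /\ forall z, inD z -> phi z = Cmult lam z.

Definition ell (z : C) : C := Cdiv (Cplus (RtoC 1) z) (Cminus (RtoC 1) z).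

Definition T_op (F phi : C -> C) (f : C -> C) : C -> C :=
  fun z => Cmult (F z) (f (phi z)).

Definition T_iter (F phi : C -> C) (n : nat) (f : C -> C) : C -> C :=
  Nat.iter n (T_op F phi) f.

Definition is_fixed (F phi : C -> C) (G : C -> C) : Prop :=
  forall z, inD z -> T_op F phi G z = G z.

Definition compact_C (K : C -> Prop) : Prop :=
  forall (I : Type) (U : I -> C -> Prop),
    (forall i, @open C_UniformSpace (U i)) ->
    (forall z, K z -> exists i, U i z) ->
    exists l : list I, forall z, K z -> exists i, In i l /\ U i z.

Definition cvg_locally_uniformly_D (g : nat -> C -> C) (G : C -> C) : Prop :=
  forall K : C -> Prop, compact_C K -> (forall z, K z -> inD z) ->
  forall eps : R, 0 < eps -> exists N : nat, forall n : nat, (N <= n)%nat ->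
    forall z, K z -> Cmod (Cminus (g n z) (G z)) < eps.

Definition null_set (E : R -> Prop) : Prop :=
  forall eps : R, 0 < eps ->
    exists a b : nat -> R,
      (forall x, E x -> exists n, a n < x < b n) /\
      (forall n, a n <= b n) /\
      (forall N, sum_f_R0 (fun n => b n - a n) N <= eps).

Definition cis (t : R) : C := (cos t, sin t).

Definition radial_limit (phi : C -> C) (t : R) (L : C) : Prop :=
  filterlim (fun r : R => phi (Cmult (RtoC r) (cis t))) (at_left 1) (locally L).

Definition is_inner (phi : C -> C) : Prop :=
  analytic_on_D phi /\ (forall z, inD z -> Cmod (phi z) <= 1) /\
  null_set (fun t => ~ exists L : C, radial_limit phi t L /\ Cmod L = 1).

(* Main.v *)
Require Import Defs.
From Stdlib Require Import Reals List Lra Lia Classical ClassicalEpsilon.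
From Coquelicot Require Import Coquelicot.
Open Scope R_scope.

(** Put [F_n = T^n 1], so that [T^n f = F_n * (f o phi^n)] and [F_(n+1) = F_n * (F o phi^n)].
    Since [phi] is not a rotation, the Schwarz lemma applied to [phi(z) / z] and Schwarz-Pick give
    [|phi(z)| <= c |z|] on [|z| <= r] with some [c < 1], while [|f(z) - 1| <= |z| |f(z) + 1|] for [f]
    in the class P. Hence [F_n] converges geometrically and [T^n f - F_n -> 0], uniformly on [|z| <= r].
    If [phi] is inner, testing [T] on [z |-> ell(lam z)] with [lam phi(z) = +- i |phi(z)|] yields
    [4 |phi| |Im omega| <= 1 - |phi|^2], so [Im omega] tends to 0 radially almost everywhere. By bounded
    convergence and [mean(omega^2) = omega(0)^2 = 0] the means of [|omega|^2] on circles of radius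
    tending to 1 tend to 0, hence [omega = 0], [F = 1], and the constant 1 is a fixed point. *)

(** * Limits and complex differentiability *)

(** Differentiability on the disk is given pointwise, with no continuity of the derivative, so
    Cauchy's theory has to start from Goursat's argument. It is run once, on a parameter rectangle
    whose image is swept by the segments from [z] to a circle; periodicity in the angle closes the
    contour, and Cauchy's formula follows without primitives or winding numbers. Null sets are given
    by interval covers and the integrals are Riemann integrals, so almost everywhere convergence is
    exploited through Arzela's theorem. The inequality for [Im omega] comes from Re (ell x * ell y)
    > 0, which after clearing denominators reads 4 Im x Im y < (1 - |x|^2)(1 - |y|^2); for fixed |y|
    it says most about Im x when y is purely imaginary. It gives no control of Re omega. That
    control comes from analyticity: Re (omega^2) has mean 0 on circles, so |omega|^2 and 2 (Im
    omega)^2 have the same mean. *)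

Ltac fold_C :=
  repeat match goal with w : UniformSpace.sort C_UniformSpace |- _ => change C in w end;
  match goal with |- @eq _ ?a ?b => change (@eq C a b) end.
(** Points bound by filters, and equations about them, are typed in the carrier of [C_UniformSpace];
    [ring] and [field] recognise only [C], hence the conversion by [fold_C]. *)
Ltac cring := fold_C; ring.
Ltac cfield := fold_C; field.

(** The uniform structure of [C_UniformSpace] is that of a product, with squares as balls; a limit
    stated by [Cmod] can be estimated directly. The filter is left arbitrary so that one limit
    calculus serves complex points, real parameters and radial approach. *)
Definition tends {T : Type} (F : (T -> Prop) -> Prop) (f : T -> C) (l : C) : Prop :=
  forall eps, 0 < eps -> F (fun x => Cmod (f x - l)%C < eps).

Lemma Cmod_sub_sym (a b : C) : Cmod (a - b)%C = Cmod (b - a)%C.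
Proof. rewrite <- (Cmod_opp (b - a)%C). f_equal. ring. Qed.

Lemma Cmod_sub_0 (a : C) : Cmod (a - a)%C = 0.
Proof. replace (a - a)%C with (RtoC 0) by ring. apply Cmod_0. Qed.

Lemma Cmod_tri_sub (a b : C) : Cmod (a - b)%C <= Cmod a + Cmod b.
Proof. rewrite <- (Cmod_opp b). apply Cmod_triangle. Qed.

Lemma Cmod_ge_sub (a b : C) : Cmod a - Cmod b <= Cmod (a - b)%C.
Proof.
  assert (H := Cmod_triangle (a - b)%C b).
  replace (a - b + b)%C with a in H by ring. lra.
Qed.

Lemma Cmod_le_via (a b : C) : Cmod a <= Cmod b + Cmod (a - b)%C.
Proof. assert (H := Cmod_ge_sub a b). lra. Qed.

Lemma Cmod_eq_sub_0 (a b : C) : Cmod (a - b)%C <= 0 -> a = b.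
Proof.
  intros H. assert (H0 : Cmod (a - b)%C = 0) by (assert (Hp := Cmod_ge_0 (a-b)%C); lra).
  apply Cmod_eq_0 in H0. replace a with ((a - b) + b)%C by ring. rewrite H0. ring.
Qed.

Lemma Cmod_sqr (a : C) : Cmod a * Cmod a = Re a * Re a + Im a * Im a.
Proof.
  unfold Cmod. rewrite sqrt_sqrt; unfold Re, Im; nra.
Qed.

Lemma abs_Re_le (a : C) : Rabs (Re a) <= Cmod a.
Proof.
  assert (H := Cmod_sqr a). assert (H' := Cmod_ge_0 a).
  apply Rabs_le. split; nra.
Qed.

Lemma abs_Im_le (a : C) : Rabs (Im a) <= Cmod a.
Proof.
  assert (H := Cmod_sqr a). assert (H' := Cmod_ge_0 a).
  apply Rabs_le. split; nra.
Qed.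

Lemma Cmod_le_Re_Im (a : C) : Cmod a <= Rabs (Re a) + Rabs (Im a).
Proof.
  assert (H := Cmod_sqr a). assert (H' := Cmod_ge_0 a).
  assert (H1 := Rabs_pos (Re a)). assert (H2 := Rabs_pos (Im a)).
  assert (H3 : Rabs (Re a) * Rabs (Re a) = Re a * Re a) by (rewrite <- Rabs_mult; apply Rabs_pos_eq; nra).
  assert (H4 : Rabs (Im a) * Rabs (Im a) = Im a * Im a) by (rewrite <- Rabs_mult; apply Rabs_pos_eq; nra).
  nra.
Qed.

Section Tends.
Context {T : Type} {F : (T -> Prop) -> Prop} {FF : Filter F}.

Lemma tends_const (c : C) : tends F (fun _ => c) c.
Proof.
  intros eps He. apply filter_forall. intros _. now rewrite Cmod_sub_0.
Qed.

Lemma tends_ext (f g : T -> C) (l : C) :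
  F (fun x => f x = g x) -> tends F f l -> tends F g l.
Proof.
  intros H Hf eps He. generalize (filter_and _ _ H (Hf eps He)).
  apply filter_imp. intros x [-> Hx]. exact Hx.
Qed.

Lemma tends_plus (f g : T -> C) (a b : C) :
  tends F f a -> tends F g b -> tends F (fun x => f x + g x)%C (a + b)%C.
Proof.
  intros Hf Hg eps He.
  assert (He2 : 0 < eps / 2) by lra.
  generalize (filter_and _ _ (Hf _ He2) (Hg _ He2)).
  apply filter_imp. intros x [H1 H2].
  replace (f x + g x - (a + b))%C with ((f x - a) + (g x - b))%C by ring.
  eapply Rle_lt_trans; [apply Cmod_triangle|lra].
Qed.

Lemma tends_mult (f g : T -> C) (a b : C) :
  tends F f a -> tends F g b -> tends F (fun x => f x * g x)%C (a * b)%C.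
Proof.
  intros Hf Hg eps He.
  set (M := 1 + Cmod a + Cmod b).
  assert (Ha := Cmod_ge_0 a). assert (Hb := Cmod_ge_0 b).
  assert (HM : 0 < M) by (unfold M; lra).
  assert (Hd : 0 < Rmin 1 (eps / (2 * M))).
  { apply Rmin_pos; [lra|]. apply Rdiv_lt_0_compat; lra. }
  generalize (filter_and _ _ (Hf _ Hd) (Hg _ Hd)).
  apply filter_imp. intros x [H1 H2].
  set (d := Rmin 1 (eps / (2 * M))) in *.
  assert (Hd1 : d <= 1) by apply Rmin_l.
  assert (Hd2 : d * M <= eps / 2).
  { apply Rle_trans with (eps / (2 * M) * M).
    - apply Rmult_le_compat_r; [lra|apply Rmin_r].
    - right. field. lra. }
  replace (f x * g x - a * b)%C with ((f x - a) * (g x - b) + ((f x - a) * b + a * (g x - b)))%C by ring.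
  eapply Rle_lt_trans; [apply Cmod_triangle|].
  eapply Rle_lt_trans; [apply Rplus_le_compat_l; apply Cmod_triangle|].
  rewrite !Cmod_mult.
  assert (P1 := Cmod_ge_0 (f x - a)%C). assert (P2 := Cmod_ge_0 (g x - b)%C).
  unfold M in Hd2. nra.
Qed.

Lemma tends_scal (c : C) (f : T -> C) (a : C) :
  tends F f a -> tends F (fun x => c * f x)%C (c * a)%C.
Proof. intros H. apply tends_mult; [apply tends_const|exact H]. Qed.

Lemma tends_opp (f : T -> C) (a : C) : tends F f a -> tends F (fun x => - f x)%C (- a)%C.
Proof.
  intros H eps He. generalize (H eps He). apply filter_imp. intros x Hx.
  rewrite <- Cmod_opp. now replace (- (- f x - - a))%C with (f x - a)%C by ring.
Qed.

Lemma tends_minus (f g : T -> C) (a b : C) :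
  tends F f a -> tends F g b -> tends F (fun x => f x - g x)%C (a - b)%C.
Proof. intros Hf Hg. apply tends_plus; [exact Hf|now apply tends_opp]. Qed.

Lemma tends_neq_0 (f : T -> C) (a : C) :
  a <> RtoC 0 -> tends F f a -> F (fun x => Cmod a / 2 < Cmod (f x)).
Proof.
  intros Ha Hf. apply Cmod_gt_0 in Ha.
  assert (Ha2 : 0 < Cmod a / 2) by lra.
  generalize (Hf _ Ha2). apply filter_imp. intros x Hx.
  rewrite Cmod_sub_sym in Hx. assert (H := Cmod_ge_sub a (f x)).
  assert (H2 := Cmod_ge_sub a (a - f x)%C). replace (a - (a - f x))%C with (f x) in H2 by ring. lra.
Qed.

Lemma Cmod_gt_neq0 (x : C) : 0 < Cmod x -> x <> RtoC 0.
Proof. intros H E. rewrite E, Cmod_0 in H. lra. Qed.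

Lemma tends_inv (f : T -> C) (a : C) :
  a <> RtoC 0 -> tends F f a -> tends F (fun x => / f x)%C (/ a)%C.
Proof.
  intros Ha Hf eps He. assert (Ha' := Ha). apply Cmod_gt_0 in Ha'.
  assert (Hd : 0 < eps * (Cmod a * Cmod a / 2)) by (repeat apply Rmult_lt_0_compat; lra).
  generalize (filter_and _ _ (tends_neq_0 f a Ha Hf) (Hf _ Hd)).
  apply filter_imp. intros x [H1 H2].
  assert (Hx : f x <> RtoC 0) by (apply Cmod_gt_neq0; lra).
  replace (/ f x - / a)%C with ((a - f x) * / (f x * a))%C by (field; auto).
  rewrite Cmod_mult, Cmod_inv, Cmod_mult, Cmod_sub_sym.
  2: now apply Cmult_neq_0.
  apply Rmult_lt_reg_r with (Cmod (f x) * Cmod a); [nra|].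
  rewrite Rmult_assoc, Rinv_l by nra.
  assert (eps * (Cmod a * Cmod a / 2) <= eps * (Cmod (f x) * Cmod a)) by (apply Rmult_le_compat_l; nra).
  lra.
Qed.

End Tends.

Lemma tends_filterlim {T : Type} (F : (T -> Prop) -> Prop) {FF : Filter F} (f : T -> C) (l : C) :
  filterlim f F (locally (T := C_UniformSpace) l) -> tends F f l.
Proof.
  intros H eps He. apply (H (fun w => Cmod (w - l)%C < eps)).
  apply (proj2 (locally_C l _)). exists (mkposreal eps He). intros w Hw. exact Hw.
Qed.

Lemma locally_Cmod (z : C) (P : C -> Prop) :
  locally (T := C_UniformSpace) z P <->
  exists d, 0 < d /\ forall w, Cmod (w - z)%C < d -> P w.
Proof.
  rewrite locally_C. split.
  - intros [d Hd]. exists d. split; [apply cond_pos|]. intros w Hw. apply Hd. exact Hw.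
  - intros [d [Hd H]]. exists (mkposreal d Hd). intros w Hw. apply H. exact Hw.
Qed.

Notation locC := (locally (T := C_UniformSpace)).
Notation locR := (locally (T := R_UniformSpace)).

(* Caratheodory's form of differentiability: products and quotients reduce to limits. *)
Definition cdiff (f : C -> C) (z : C) : Prop :=
  exists (q : C -> C) (l : C),
    tends (locC z) q l /\ locC z (fun w => f w = f z + q w * (w - z))%C.

Lemma tends_id (z : C) : tends (locC z) (fun w => w) z.
Proof.
  intros eps He. apply locally_Cmod. exists eps. auto.
Qed.

Lemma cdiff_tends (f : C -> C) (z : C) : cdiff f z -> tends (locC z) f (f z).
Proof.
  intros [q [l [Hq Hf]]].
  apply tends_ext with (fun w => f z + q w * (w - z))%C.
  - revert Hf. apply filter_imp. auto.
  - assert (E : (f z + l * (z - z) = f z)%C) by cring.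
    apply (eq_ind _ (tends (locC z) _)) with (2 := E).
    apply tends_plus; [apply tends_const|]. apply tends_mult; [exact Hq|].
    apply tends_minus; [apply tends_id|apply tends_const].
Qed.

Lemma cdiff_const (c z : C) : cdiff (fun _ => c) z.
Proof.
  exists (fun _ => RtoC 0), (RtoC 0). split; [apply tends_const|].
  apply filter_forall. intros w. cring.
Qed.

Lemma cdiff_id (z : C) : cdiff (fun w => w) z.
Proof.
  exists (fun _ => RtoC 1), (RtoC 1). split; [apply tends_const|].
  apply filter_forall. intros w. cring.
Qed.

Lemma cdiff_ext (f g : C -> C) (z : C) :
  locC z (fun w => f w = g w) -> cdiff f z -> cdiff g z.
Proof.
  intros E [q [l [Hq Hf]]]. exists q, l. split; [exact Hq|].
  assert (Ez : f z = g z) by exact (locally_singleton _ _ E).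
  generalize (filter_and _ _ E Hf). apply filter_imp. intros w [<- H].
  now rewrite <- Ez.
Qed.

Lemma cdiff_plus (f g : C -> C) (z : C) :
  cdiff f z -> cdiff g z -> cdiff (fun w => f w + g w)%C z.
Proof.
  intros [q [l [Hq Hf]]] [q' [l' [Hq' Hg]]].
  exists (fun w => q w + q' w)%C, (l + l')%C. split; [now apply tends_plus|].
  generalize (filter_and _ _ Hf Hg). apply filter_imp. intros w [-> ->]. cring.
Qed.

Lemma cdiff_mult (f g : C -> C) (z : C) :
  cdiff f z -> cdiff g z -> cdiff (fun w => f w * g w)%C z.
Proof.
  intros Df Dg. assert (Cg := cdiff_tends g z Dg).
  destruct Df as [q [l [Hq Hf]]]. destruct Dg as [q' [l' [Hq' Hg]]].
  exists (fun w => q w * g w + f z * q' w)%C, (l * g z + f z * l')%C. split.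
  - apply tends_plus; apply tends_mult; try apply tends_const; assumption.
  - generalize (filter_and _ _ Hf Hg). apply filter_imp. intros w [-> E].
    transitivity (f z * g w + q w * (w - z) * g w)%C; [cring|].
    replace (f z * g w)%C with (f z * (g z + q' w * (w - z)))%C by now rewrite <- E. cring.
Qed.

Lemma cdiff_scal (c : C) (f : C -> C) (z : C) : cdiff f z -> cdiff (fun w => c * f w)%C z.
Proof. intros H. apply cdiff_mult; [apply cdiff_const|exact H]. Qed.

Lemma cdiff_minus (f g : C -> C) (z : C) :
  cdiff f z -> cdiff g z -> cdiff (fun w => f w - g w)%C z.
Proof.
  intros Hf Hg. apply cdiff_ext with (fun w => f w + - RtoC 1 * g w)%C.
  - apply filter_forall. intros w. cring.
  - apply cdiff_plus; [exact Hf|now apply cdiff_scal].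
Qed.

Lemma cdiff_inv (f : C -> C) (z : C) :
  f z <> RtoC 0 -> cdiff f z -> cdiff (fun w => / f w)%C z.
Proof.
  intros Hz Df. assert (Cf := cdiff_tends f z Df).
  destruct Df as [q [l [Hq Hf]]].
  exists (fun w => - q w * / (f w * f z))%C, (- l * / (f z * f z))%C. split.
  - apply tends_mult; [now apply tends_opp|]. apply tends_inv; [now apply Cmult_neq_0|].
    apply tends_mult; [exact Cf|apply tends_const].
  - generalize (filter_and _ _ Hf (tends_neq_0 f (f z) Hz Cf)). apply filter_imp.
    intros w [E H]. assert (Hw : f w <> RtoC 0).
    { apply Cmod_gt_neq0. apply Cmod_gt_0 in Hz. lra. }
    transitivity (/ f z - (q w * (w - z)) * / (f w * f z))%C; [|cring].
    replace (q w * (w - z))%C with (f w - f z)%C by (rewrite E at 1; cring).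
    cfield. auto.
Qed.

Lemma cdiff_div (f g : C -> C) (z : C) :
  g z <> RtoC 0 -> cdiff f z -> cdiff g z -> cdiff (fun w => f w / g w)%C z.
Proof. intros Hz Hf Hg. apply cdiff_mult; [exact Hf|now apply cdiff_inv]. Qed.

Lemma cdiff_pow (f : C -> C) (z : C) (n : nat) : cdiff f z -> cdiff (fun w => Cpow (f w) n) z.
Proof.
  intros H. induction n as [|n IH]; simpl; [apply cdiff_const|now apply cdiff_mult].
Qed.

Lemma ex_derive_cdiff (f : C -> C) (z : C) :
  @ex_derive C_AbsRing C_NormedModule f z -> cdiff f z.
Proof.
  intros [l [_ H]]. specialize (H z (fun P HP => HP)).
  exists (fun w => match excluded_middle_informative (@eq C w z) with
                   | left _ => l | right _ => (f w - f z) / (w - z) end)%C, l.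
  split.
  (* The derivative comes with a non-strict error bound while [tends] asks for a strict one, hence
     the half. *)
  - intros eps He. assert (He2 : 0 < eps / 2) by lra. specialize (H (mkposreal _ He2)).
    apply (proj2 (locally_C z _)). revert H. apply filter_imp. intros w Hw.
    cbv beta. destruct (excluded_middle_informative (@eq C w z)) as [E|N].
    + change (Cmod (l - l)%C < eps). rewrite Cmod_sub_0. exact He.
    + assert (Hwz : (w - z)%C <> RtoC 0).
      { intros E. apply N. replace w with ((w - z) + z)%C by cring. rewrite E. cring. }
      change (Cmod (f w - f z - (w - z) * l)%C <= eps / 2 * Cmod (w - z)%C) in Hw.
      assert (P := proj1 (Cmod_gt_0 _) Hwz).
      replace ((f w - f z) / (w - z) - l)%C with ((f w - f z - (w - z) * l) / (w - z))%C by (cfield; auto).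
      rewrite Cmod_div by auto. apply Rle_lt_trans with (eps/2); [|lra].
      apply Rmult_le_reg_r with (Cmod (w - z)%C); [lra|]. unfold Rdiv at 1.
      rewrite Rmult_assoc, Rinv_l by lra. lra.
  - apply filter_forall. intros w.
    destruct (excluded_middle_informative (@eq C w z)) as [->|N]; [cring|].
    cfield. intros E. apply N. replace w with ((w - z) + z)%C by cring. rewrite E. cring.
Qed.

Lemma cdiff_ex_derive (f : C -> C) (z : C) :
  cdiff f z -> @ex_derive C_AbsRing C_NormedModule f z.
Proof.
  intros [q [l [Hq Hf]]]. exists l. split.
  - apply is_linear_scal_l.
  - intros x Hx. assert (E : z = x) by now apply (is_filter_lim_locally_unique (V:=AbsRing_NormedModule C_AbsRing)).
    subst x. intros eps.
    generalize (filter_and _ _ Hf (Hq eps (cond_pos eps))). intros H.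
    apply (proj1 (locally_C z _)) in H. revert H. apply filter_imp. intros w [E H].
    change (Cmod (f w - f z - (w - z) * l)%C <= eps * Cmod (w - z)%C).
    rewrite E. replace (f z + q w * (w - z) - f z - (w - z) * l)%C with ((q w - l) * (w - z))%C by cring.
    rewrite Cmod_mult. apply Rmult_le_compat_r; [apply Cmod_ge_0|lra].
Qed.

Lemma cdiff_approx (f : C -> C) (z : C) : cdiff f z ->
  exists l, forall eps, 0 < eps -> exists d, 0 < d /\
    forall w, Cmod (w - z)%C < d -> Cmod (f w - f z - l * (w - z))%C <= eps * Cmod (w - z)%C.
Proof.
  intros [q [l [Hq Hf]]]. exists l. intros eps He.
  destruct (proj1 (locally_Cmod _ _) (filter_and _ _ Hf (Hq eps He))) as [d [Hd H]].
  exists d. split; [exact Hd|]. intros w Hw. destruct (H w Hw) as [E H'].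
  rewrite E. replace (f z + q w * (w - z) - f z - l * (w - z))%C with ((q w - l) * (w - z))%C by cring.
  rewrite Cmod_mult. apply Rmult_le_compat_r; [apply Cmod_ge_0|lra].
Qed.

(** * Integrals of complex-valued functions *)

Definition rcont (f : R -> C) (t : R) : Prop := tends (locR t) f (f t).

(** Coordinates are integrated separately so that the real theory applies verbatim; only the modulus
    bound [is_CI_norm_le] then needs an idea. *)
Definition is_CI (f : R -> C) (a b : R) (I : C) : Prop :=
  is_RInt (fun t => Re (f t)) a b (Re I) /\ is_RInt (fun t => Im (f t)) a b (Im I).

Definition CI (f : R -> C) (a b : R) : C :=
  (RInt (fun t => Re (f t)) a b, RInt (fun t => Im (f t)) a b).

Lemma rcont_Re (f : R -> C) (t : R) : rcont f t -> continuous (fun t => Re (f t)) t.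
Proof.
  intros H. apply filterlim_locally. intros eps.
  generalize (H eps (cond_pos eps)). apply filter_imp. intros u Hu.
  apply Rle_lt_trans with (2 := Hu). exact (abs_Re_le (f u - f t)%C).
Qed.

Lemma rcont_Im (f : R -> C) (t : R) : rcont f t -> continuous (fun t => Im (f t)) t.
Proof.
  intros H. apply filterlim_locally. intros eps.
  generalize (H eps (cond_pos eps)). apply filter_imp. intros u Hu.
  apply Rle_lt_trans with (2 := Hu). exact (abs_Im_le (f u - f t)%C).
Qed.

Lemma rcont_RtoC (f : R -> R) (t : R) : continuous f t -> rcont (fun u => RtoC (f u)) t.
Proof.
  intros H eps He. generalize (proj1 (filterlim_locally f (f t)) H (mkposreal eps He)).
  apply filter_imp. intros u Hu. rewrite <- RtoC_minus, Cmod_R. exact Hu.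
Qed.

Lemma rcont_cis (t : R) : rcont cis t.
Proof.
  unfold rcont.
  apply tends_ext with (fun u => RtoC (cos u) + Ci * RtoC (sin u))%C.
  - apply filter_forall. intros u. unfold cis, Cplus, Cmult, Ci, RtoC; simpl. f_equal; ring.
  - assert (E : (RtoC (cos t) + Ci * RtoC (sin t))%C = cis t).
    { unfold cis, Cplus, Cmult, Ci, RtoC; simpl. f_equal; ring. }
    rewrite <- E. apply tends_plus; [|apply tends_scal]; apply rcont_RtoC.
    + apply continuous_cos.
    + apply continuous_sin.
Qed.

Lemma tends_comp_cont {T : Type} {F : (T -> Prop) -> Prop} {FF : Filter F}
  (g : T -> C) (f : C -> C) (z : C) :
  tends F g z -> tends (locC z) f (f z) -> tends F (fun x => f (g x)) (f z).
Proof.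
  intros Hg Hf eps He. destruct (proj1 (locally_Cmod _ _) (Hf eps He)) as [d [Hd H]].
  generalize (Hg d Hd). apply filter_imp. intros x Hx. apply H, Hx.
Qed.

Lemma rcont_comp (f : C -> C) (g : R -> C) (t : R) :
  cdiff f (g t) -> rcont g t -> rcont (fun u => f (g u)) t.
Proof. intros Hf Hg. apply tends_comp_cont; [exact Hg|now apply cdiff_tends]. Qed.

Lemma is_CI_unique (f : R -> C) (a b : R) (I : C) : is_CI f a b I -> CI f a b = I.
Proof.
  intros [H1 H2]. unfold CI. rewrite (is_RInt_unique _ _ _ _ H1), (is_RInt_unique _ _ _ _ H2).
  now destruct I.
Qed.

Lemma is_CI_CI (f : R -> C) (a b : R) :
  a <= b -> (forall t, a <= t <= b -> rcont f t) -> is_CI f a b (CI f a b).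
Proof.
  intros Hab H. split; simpl; apply (RInt_correct (V := R_CompleteNormedModule));
    apply (ex_RInt_continuous (V := R_CompleteNormedModule)); intros t Ht;
    rewrite Rmin_left, Rmax_right in Ht by lra.
  - now apply rcont_Re, H.
  - now apply rcont_Im, H.
Qed.

Lemma is_CI_ext (f g : R -> C) (a b : R) (I : C) :
  a <= b -> (forall t, a <= t <= b -> f t = g t) -> is_CI f a b I -> is_CI g a b I.
Proof.
  intros Hab E [H1 H2]. split; [revert H1|revert H2]; apply is_RInt_ext; intros t Ht;
    rewrite Rmin_left, Rmax_right in Ht by lra; rewrite E; auto; lra.
Qed.

Lemma is_CI_plus (f g : R -> C) (a b : R) (I J : C) :
  is_CI f a b I -> is_CI g a b J -> is_CI (fun t => f t + g t)%C a b (I + J)%C.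
Proof.
  intros [H1 H2] [H3 H4]. split.
  - exact (is_RInt_plus _ _ _ _ _ _ H1 H3).
  - exact (is_RInt_plus _ _ _ _ _ _ H2 H4).
Qed.

Lemma is_CI_scal (c : C) (f : R -> C) (a b : R) (I : C) :
  is_CI f a b I -> is_CI (fun t => c * f t)%C a b (c * I)%C.
Proof.
  intros [H1 H2]. split.
  - exact (is_RInt_minus _ _ _ _ _ _ (is_RInt_scal _ _ _ (fst c) _ H1) (is_RInt_scal _ _ _ (snd c) _ H2)).
  - exact (is_RInt_plus _ _ _ _ _ _ (is_RInt_scal _ _ _ (fst c) _ H2) (is_RInt_scal _ _ _ (snd c) _ H1)).
Qed.

Lemma is_CI_const (c : C) (a b : R) : is_CI (fun _ => c) a b (RtoC (b - a) * c)%C.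
Proof.
  split.
  - replace (Re (RtoC (b - a) * c)%C) with (scal (b - a) (Re c)).
    + apply (is_RInt_const (V := R_NormedModule)).
    + unfold scal; simpl; unfold mult; simpl; unfold Re; simpl. ring.
  - replace (Im (RtoC (b - a) * c)%C) with (scal (b - a) (Im c)).
    + apply (is_RInt_const (V := R_NormedModule)).
    + unfold scal; simpl; unfold mult; simpl; unfold Im; simpl. ring.
Qed.

Lemma is_CI_Chasles (f : R -> C) (a b c : R) (I J : C) :
  is_CI f a b I -> is_CI f b c J -> is_CI f a c (I + J)%C.
Proof.
  intros [H1 H2] [H3 H4]. split.
  - exact (is_RInt_Chasles _ _ _ _ _ _ H1 H3).
  - exact (is_RInt_Chasles _ _ _ _ _ _ H2 H4).
Qed.

Lemma CI_Chasles (f : R -> C) (a b c : R) :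
  a <= b -> b <= c -> (forall t, a <= t <= c -> rcont f t) ->
  CI f a c = (CI f a b + CI f b c)%C.
Proof.
  intros Hab Hbc H. apply is_CI_unique.
  apply is_CI_Chasles with b; apply is_CI_CI; auto; intros t Ht; apply H; lra.
Qed.

(* Rotating the integral onto the positive real axis reduces the bound to a real integral. *)
Lemma is_CI_norm_le (f : R -> C) (g : R -> R) (a b : R) (I : C) (J : R) :
  a <= b -> (forall t, a <= t <= b -> Cmod (f t) <= g t) ->
  is_CI f a b I -> is_RInt g a b J -> Cmod I <= J.
Proof.
  intros Hab Hfg HI HJ.
  destruct (Req_dec (Cmod I) 0) as [E|N].
  - rewrite E. apply (is_RInt_ge_0 g a b J); auto. intros t Ht.
    apply Rle_trans with (Cmod (f t)); [apply Cmod_ge_0|apply Hfg; lra].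
  - assert (P : 0 < Cmod I) by (assert (Hp := Cmod_ge_0 I); lra).
    assert (H := proj1 (is_CI_scal (Cconj I) _ _ _ _ HI)).
    assert (H' := is_RInt_scal _ _ _ (Cmod I) _ HJ).
    assert (L := is_RInt_le _ _ _ _ _ _ Hab H H').
    assert (E : Re (Cconj I * I)%C = Cmod I * Cmod I).
    { rewrite Cmod_sqr. unfold Re, Im, Cconj; simpl. ring. }
    rewrite E in L. change (scal (Cmod I) J) with (Cmod I * J) in L.
    apply Rmult_le_reg_l with (Cmod I); [exact P|]. apply L. intros t Ht.
    apply Rle_trans with (Cmod (Cconj I * f t)%C).
    + apply Rle_trans with (2 := abs_Re_le _). apply Rle_abs.
    + rewrite Cmod_mult, Cmod_conj. apply Rmult_le_compat_l; [lra|]. apply Hfg; lra.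
Qed.

Lemma is_CI_norm_le_const (f : R -> C) (a b M : R) (I : C) :
  a <= b -> (forall t, a <= t <= b -> Cmod (f t) <= M) ->
  is_CI f a b I -> Cmod I <= M * (b - a).
Proof.
  intros Hab Hf HI. apply (is_CI_norm_le f (fun _ => M) a b I); auto.
  replace (M * (b - a)) with (scal (b - a) M).
  - apply (is_RInt_const (V := R_NormedModule)).
  - unfold scal; simpl; unfold mult; simpl. ring.
Qed.

Lemma is_CI_conj (f : R -> C) (a b : R) (I : C) :
  is_CI f a b I -> is_CI (fun t => Cconj (f t)) a b (Cconj I).
Proof.
  intros [H1 H2]. split; [exact H1|]. exact (is_RInt_opp _ _ _ _ H2).
Qed.

Lemma is_CI_cis (a b : R) : is_CI (fun t => Ci * cis t)%C a b (cis b - cis a)%C.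
Proof.
  split.
  - apply is_RInt_ext with (fun t => - sin t).
    + intros t _. unfold Re, Ci, cis; simpl. ring.
    + apply (is_RInt_derive (V := R_CompleteNormedModule) cos).
      * intros t _. apply is_derive_cos.
      * intros t _. apply (continuous_opp (V := R_NormedModule)), continuous_sin.
  - apply is_RInt_ext with cos.
    + intros t _. unfold Im, Ci, cis; simpl. ring.
    + apply (is_RInt_derive (V := R_CompleteNormedModule) sin).
      * intros t _. apply is_derive_sin.
      * intros t _. apply continuous_cos.
Qed.

Lemma Cmod_cis (t : R) : Cmod (cis t) = 1.
Proof.
  assert (H := Cmod_sqr (cis t)). assert (H' := Cmod_ge_0 (cis t)).
  assert (H2 := sin2_cos2 t). unfold Rsqr in H2. change (Re (cis t)) with (cos t) in H.
  change (Im (cis t)) with (sin t) in H. nra.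
Qed.

Lemma cis_lipschitz (a b : R) : Cmod (cis b - cis a)%C <= Rabs (b - a).
Proof.
  assert (K : forall a b, a <= b -> Cmod (cis b - cis a)%C <= Rabs (b - a)).
  { clear. intros a b Hab. rewrite Rabs_pos_eq by lra. rewrite <- (Rmult_1_l (b - a)).
    apply (is_CI_norm_le_const (fun t => Ci * cis t)%C); [exact Hab| |apply is_CI_cis].
    intros t _. rewrite Cmod_mult, Cmod_cis. unfold Cmod, Ci; simpl.
    replace (0 * (0 * 1) + 1 * (1 * 1)) with 1 by ring. rewrite sqrt_1. lra. }
  destruct (Rle_dec a b) as [H|H]; [now apply K|].
  rewrite Cmod_sub_sym, Rabs_minus_sym. apply K. lra.
Qed.

Lemma cis_period : cis (2 * PI) = cis 0.
Proof. unfold cis. now rewrite cos_2PI, sin_2PI, cos_0, sin_0. Qed.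

(** * Goursat's quartering argument *)

Section Goursat.
Variables (A B : R -> R -> R -> C) (a b c d : R).
Hypotheses (Hab : a < b) (Hcd : c < d).

(** [A t] and [B s] stand for the integrals of a 1-form along horizontal and vertical edges, and [J]
    is its counterclockwise circulation around a rectangle. The argument uses only additivity along
    edges and, in [J_local], that the circulation around small rectangles containing a given point
    is o(size^2). *)
Let J (s0 s1 t0 t1 : R) : C := (A t0 s0 s1 - A t1 s0 s1 + B s1 t0 t1 - B s0 t0 t1)%C.

Hypothesis A_Chasles : forall t s0 s1 s2, c <= t <= d -> a <= s0 -> s0 <= s1 -> s1 <= s2 -> s2 <= b ->
  A t s0 s2 = (A t s0 s1 + A t s1 s2)%C.
Hypothesis B_Chasles : forall s t0 t1 t2, a <= s <= b -> c <= t0 -> t0 <= t1 -> t1 <= t2 -> t2 <= d ->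
  B s t0 t2 = (B s t0 t1 + B s t1 t2)%C.
Hypothesis J_local : forall s t eps, a <= s <= b -> c <= t <= d -> 0 < eps ->
  exists del, 0 < del /\ forall s0 s1 t0 t1,
    a <= s0 -> s0 <= s <= s1 -> s1 <= b -> c <= t0 -> t0 <= t <= t1 -> t1 <= d ->
    s1 - s0 < del -> t1 - t0 < del ->
    Cmod (J s0 s1 t0 t1) <= eps * ((s1 - s0) + (t1 - t0)) ^ 2.

Lemma J_quarter (s0 s1 s2 t0 t1 t2 : R) :
  a <= s0 -> s0 <= s1 -> s1 <= s2 -> s2 <= b -> c <= t0 -> t0 <= t1 -> t1 <= t2 -> t2 <= d ->
  J s0 s2 t0 t2 = (J s0 s1 t0 t1 + J s1 s2 t0 t1 + J s0 s1 t1 t2 + J s1 s2 t1 t2)%C.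
Proof.
  intros. unfold J.
  rewrite (A_Chasles t0 s0 s1 s2), (A_Chasles t2 s0 s1 s2), (B_Chasles s2 t0 t1 t2),
    (B_Chasles s0 t0 t1 t2) by lra.
  ring.
Qed.

(** A rectangle of generation [n] has sides (b - a) / 2^n and (d - c) / 2^n, so its lower left
    corner [p] determines it. It is [bad] when it still carries its full share e / 4^n of the
    circulation. *)
Let inbox (n : nat) (p : R * R) : Prop :=
  a <= fst p /\ fst p + (b - a) / 2 ^ n <= b /\ c <= snd p /\ snd p + (d - c) / 2 ^ n <= d.
Let Jn (n : nat) (p : R * R) : C :=
  J (fst p) (fst p + (b - a) / 2 ^ n) (snd p) (snd p + (d - c) / 2 ^ n).
Let bad (e : R) (n : nat) (p : R * R) : Prop := inbox n p /\ e / 4 ^ n <= Cmod (Jn n p).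

Lemma half_scale (n : nat) (h : R) : h / 2 ^ n = 2 * (h / 2 ^ S n).
Proof. simpl. field. apply pow_nonzero. lra. Qed.

Lemma scale_pos (n : nat) (h : R) : 0 < h -> 0 < h / 2 ^ n.
Proof. intros. apply Rdiv_lt_0_compat; [lra|apply pow_lt; lra]. Qed.

(** Pigeonhole: four quarters each below e / 4^(n+1) could not add up to e / 4^n. *)
Lemma bad_step (e : R) (n : nat) (p : R * R) : bad e n p ->
  exists p', bad e (S n) p' /\
    fst p <= fst p' <= fst p + (b - a) / 2 ^ S n /\
    snd p <= snd p' <= snd p + (d - c) / 2 ^ S n.
Proof.
  destruct p as [x y]. intros [[H1 [H2 [H3 H4]]] H]. simpl fst in *; simpl snd in *.
  unfold Jn in H; simpl fst in H; simpl snd in H.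
  rewrite (half_scale n (b - a)) in *. rewrite (half_scale n (d - c)) in *.
  assert (Hh := scale_pos (S n) (b - a) ltac:(lra)). assert (Hk := scale_pos (S n) (d - c) ltac:(lra)).
  set (h := (b - a) / 2 ^ S n) in *. set (k := (d - c) / 2 ^ S n) in *.
  rewrite (J_quarter x (x + h) (x + 2 * h) y (y + k) (y + 2 * k)) in H by lra.
  assert (E : e / 4 ^ n = 4 * (e / 4 ^ S n)) by (simpl; field; apply pow_nonzero; lra).
  rewrite E in H.
  assert (Q : forall x' y', x' = x \/ x' = x + h -> y' = y \/ y' = y + k ->
     e / 4 ^ S n <= Cmod (J x' (x' + h) y' (y' + k)) ->
     exists p', bad e (S n) p' /\ x <= fst p' <= x + h /\ y <= snd p' <= y + k).
  { intros x' y' Hx Hy HJ. exists (x', y'). simpl fst; simpl snd. split; [split|].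
    - unfold inbox; simpl fst; simpl snd. fold h k. destruct Hx, Hy; subst; lra.
    - exact HJ.
    - destruct Hx, Hy; subst; lra. }
  destruct (Rle_dec (e / 4 ^ S n) (Cmod (J x (x + h) y (y + k)))) as [G|G1]; [now apply (Q x y); auto|].
  destruct (Rle_dec (e / 4 ^ S n) (Cmod (J (x + h) (x + h + h) y (y + k)))) as [G|G2]; [now apply (Q (x+h) y); auto|].
  destruct (Rle_dec (e / 4 ^ S n) (Cmod (J x (x + h) (y + k) (y + k + k)))) as [G|G3]; [now apply (Q x (y+k)); auto|].
  destruct (Rle_dec (e / 4 ^ S n) (Cmod (J (x + h) (x + h + h) (y + k) (y + k + k)))) as [G|G4]; [now apply (Q (x+h) (y+k)); auto|].
  exfalso. replace (x + 2 * h) with (x + h + h) in H by ring. replace (y + 2 * k) with (y + k + k) in H by ring.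
  match type of H with _ <= Cmod (?u + ?v + ?w + ?z)%C =>
    assert (T1 := Cmod_triangle (u + v + w)%C z); assert (T2 := Cmod_triangle (u + v)%C w);
    assert (T3 := Cmod_triangle u v) end.
  lra.
Qed.

Lemma nested_limit (u : nat -> R) (h : R) : 0 < h ->
  (forall n, u n <= u (S n) <= u n + h / 2 ^ S n) ->
  exists l, forall n, u n <= l <= u n + h / 2 ^ n.
Proof.
  intros Hh Hu.
  (* The slack h / 2^(n+k) makes the bound inductive in [k]: each step consumes half of what is
     left. *)
  assert (G : forall n k, u n <= u (n + k)%nat <= u n + h / 2 ^ n - h / 2 ^ (n + k)).
  { intros n k. induction k as [|k IH].
    - rewrite Nat.add_0_r. lra.
    - rewrite Nat.add_succ_r. specialize (Hu (n + k)%nat).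
      assert (E := half_scale (n + k) h). lra. }
  assert (Lim : ex_finite_lim_seq u).
  { apply ex_finite_lim_seq_incr with (u 0%nat + h).
    - intros n. apply Hu.
    - intros n. specialize (G 0%nat n). simpl (0 + n)%nat in G. simpl (2 ^ 0) in G.
      assert (P := scale_pos n h Hh). lra. }
  destruct Lim as [l Hl]. exists l. intros n.
  apply (is_lim_seq_incr_n _ n) in Hl.
  split.
  - apply (is_lim_seq_le (fun _ => u n) (fun k => u (k + n)%nat) (u n) l); auto.
    + intros k. rewrite Nat.add_comm. apply G.
    + apply is_lim_seq_const.
  - apply (is_lim_seq_le (fun k => u (k + n)%nat) (fun _ => u n + h / 2 ^ n) l (u n + h / 2 ^ n)); auto.
    + intros k. rewrite Nat.add_comm. specialize (G n k). assert (P := scale_pos (n + k) h Hh). lra.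
    + apply is_lim_seq_const.
Qed.

Lemma goursat : J a b c d = RtoC 0.
Proof.
  apply NNPP. intros N. set (e := Cmod (J a b c d)).
  assert (He : 0 < e) by now apply Cmod_gt_0.
  assert (B0 : bad e 0 (a, c)).
  { split.
    - unfold inbox; simpl. lra.
    - unfold Jn; simpl. replace (a + (b - a) / 1) with b by field.
      replace (c + (d - c) / 1) with d by field. fold e. lra. }
  set (nxt := fun (n : nat) (p : {p : R * R | bad e n p}) =>
    constructive_indefinite_description _ (bad_step e n (proj1_sig p) (proj2_sig p))).
  set (sq := fix sq (n : nat) : {p : R * R | bad e n p} :=
    match n with
    | O => exist _ (a, c) B0
    | S n => exist _ (proj1_sig (nxt n (sq n))) (proj1 (proj2_sig (nxt n (sq n))))
    end).
  destruct (nested_limit (fun n => fst (proj1_sig (sq n))) (b - a)) as [s Hs]; [lra| |].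
  { intros n. exact (proj1 (proj2 (proj2_sig (nxt n (sq n))))). }
  destruct (nested_limit (fun n => snd (proj1_sig (sq n))) (d - c)) as [t Ht]; [lra| |].
  { intros n. exact (proj2 (proj2 (proj2_sig (nxt n (sq n))))). }
  set (L := b - a + (d - c)). assert (HL : 0 < L) by (unfold L; lra).
  (* The semiperimeter in generation [n] is L / 2^n, so this tolerance bounds the circulation by e /
     4^n / 2, half of what a bad rectangle carries. *)
  destruct (J_local s t (e / 2 / L ^ 2)) as [del [Hdel Hloc]].
  - assert (H0 := Hs 0%nat). simpl in H0. replace (a + (b - a) / 1) with b in H0 by field. lra.
  - assert (H0 := Ht 0%nat). simpl in H0. replace (c + (d - c) / 1) with d in H0 by field. lra.
  - apply Rdiv_lt_0_compat; [lra|apply pow_lt; lra].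
  - assert (Hn : exists n, L / 2 ^ n < del).
    { assert (HLd : 0 < L / del) by (apply Rdiv_lt_0_compat; lra).
      destruct (Pow_x_infinity 2 ltac:(rewrite Rabs_pos_eq; lra) (L / del + 1)) as [n Hn].
      exists n. specialize (Hn n (le_n n)).
      assert (P : 0 < 2 ^ n) by (apply pow_lt; lra).
      rewrite Rabs_pos_eq in Hn by lra.
      apply Rmult_lt_reg_r with (2 ^ n); [lra|]. unfold Rdiv. rewrite Rmult_assoc, Rinv_l by lra.
      assert (L = L / del * del) by (field; lra). nra. }
    destruct Hn as [n Hn]. specialize (Hs n). specialize (Ht n).
    destruct (sq n) as [[x y] [[H1 [H2 [H3 H4]]] HJ]]. simpl in Hs, Ht, H1, H2, H3, H4.
    unfold Jn in HJ; simpl fst in HJ; simpl snd in HJ.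
    assert (Hh := scale_pos n (b - a) ltac:(lra)). assert (Hk := scale_pos n (d - c) ltac:(lra)).
    assert (EL : L / 2 ^ n = (b - a) / 2 ^ n + (d - c) / 2 ^ n) by (unfold L; field; apply pow_nonzero; lra).
    assert (K := Hloc x (x + (b - a) / 2 ^ n) y (y + (d - c) / 2 ^ n) H1 Hs H2 H3 Ht H4 ltac:(lra) ltac:(lra)).
    replace (x + (b - a) / 2 ^ n - x + (y + (d - c) / 2 ^ n - y)) with (L / 2 ^ n) in K by (rewrite EL; ring).
    assert (E4 : e / 2 / L ^ 2 * (L / 2 ^ n) ^ 2 = e / 4 ^ n / 2).
    { replace 4 with (2 * 2) by ring. rewrite Rpow_mult_distr. field. split; [apply pow_nonzero|]; lra. }
    rewrite E4 in K. assert (0 < e / 4 ^ n) by (apply Rdiv_lt_0_compat; [lra|apply pow_lt; lra]). lra.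
Qed.
End Goursat.

(** * Cauchy's integral formula *)

Definition circ (rho t : R) : C := (RtoC rho * cis t)%C.

(** On the circle, with ζ = [circ rho t] and dζ = i ζ dt, the form [ckern rho z t] dt is dζ / (i (ζ
    - z)), the Cauchy kernel without the factor 1 / (2 pi). *)
Definition ckern (rho : R) (z : C) (t : R) : C := (circ rho t / (circ rho t - z))%C.

Lemma Cmod_circ (rho t : R) : 0 <= rho -> Cmod (circ rho t) = rho.
Proof. intros H. unfold circ. rewrite Cmod_mult, Cmod_cis, Cmod_R, Rabs_pos_eq; lra. Qed.

Lemma circ_sub_ge (rho t : R) (z : C) : 0 <= rho -> rho - Cmod z <= Cmod (circ rho t - z)%C.
Proof. intros H. assert (K := Cmod_ge_sub (circ rho t) z). rewrite Cmod_circ in K; lra. Qed.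

Lemma circ_sub_neq_0 (rho t : R) (z : C) : Cmod z < rho -> (circ rho t - z)%C <> RtoC 0.
Proof.
  intros H. apply Cmod_gt_neq0. assert (P := Cmod_ge_0 z). assert (K := circ_sub_ge rho t z). lra.
Qed.

Lemma Cmod_ckern_le (rho t : R) (z : C) : Cmod z < rho ->
  Cmod (ckern rho z t) <= rho / (rho - Cmod z).
Proof.
  intros H. assert (P := Cmod_ge_0 z). assert (K := circ_sub_ge rho t z).
  unfold ckern. rewrite Cmod_div by now apply circ_sub_neq_0. rewrite Cmod_circ by lra.
  apply Rmult_le_compat_l; [lra|]. apply Rinv_le_contravar; lra.
Qed.

Lemma rcont_circ (rho t : R) : rcont (circ rho) t.
Proof. apply tends_scal, rcont_cis. Qed.

Lemma rcont_ckern (rho t : R) (z : C) : Cmod z < rho -> rcont (ckern rho z) t.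
Proof.
  intros H. unfold rcont, ckern. apply tends_mult; [apply rcont_circ|].
  apply tends_inv; [now apply circ_sub_neq_0|].
  apply tends_minus; [apply rcont_circ|apply tends_const].
Qed.

Section CauchyFormula.
Variables (f : C -> C) (z : C) (rho : R).
Hypothesis Hz : Cmod z < rho.
Hypothesis Hf : forall w, Cmod w <= rho -> cdiff f w.

(** The homothety of centre [z] and ratio [s] applied to the circle: s = 1 is the circle itself, and
    s -> 0 shrinks it to [z]. *)
Let Gam (s t : R) : C := (z + RtoC s * (circ rho t - z))%C.
Let k (t : R) : C := ckern rho z t.
Let K : R := rho / (rho - Cmod z).

(* The closed 1-form [f(w) dw / (w - z)], pulled back by [Gam], is [f(Gam s t) (ds / s + i k(t) dt)]. *)
Let A (t s0 s1 : R) : C := CI (fun s => f (Gam s t) * / RtoC s)%C s0 s1.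
Let B (s t0 t1 : R) : C := CI (fun t => Ci * k t * f (Gam s t))%C t0 t1.

Lemma rho_pos : 0 < rho.
Proof. assert (P := Cmod_ge_0 z). lra. Qed.

Lemma K_pos : 0 < K.
Proof. assert (P := Cmod_ge_0 z). apply Rdiv_lt_0_compat; lra. Qed.

Lemma Gam_in (s t : R) : 0 <= s <= 1 -> Cmod (Gam s t) <= rho.
Proof.
  intros Hs. unfold Gam.
  replace (z + RtoC s * (circ rho t - z))%C with (RtoC (1 - s) * z + RtoC s * circ rho t)%C.
  2: { rewrite RtoC_minus. ring. }
  eapply Rle_trans; [apply Cmod_triangle|]. assert (P := rho_pos).
  rewrite !Cmod_mult, !Cmod_R, Cmod_circ, !Rabs_pos_eq by lra. nra.
Qed.

Lemma rcont_Gam_s (t s : R) : rcont (fun s => Gam s t) s.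
Proof.
  unfold rcont, Gam. apply tends_plus; [apply tends_const|]. apply tends_mult; [|apply tends_const].
  apply (rcont_RtoC (fun u => u)). apply continuous_id.
Qed.

Lemma rcont_Gam_t (s t : R) : rcont (fun t => Gam s t) t.
Proof.
  unfold rcont, Gam. apply tends_plus; [apply tends_const|]. apply tends_scal.
  apply tends_minus; [apply rcont_circ|apply tends_const].
Qed.

Lemma rcont_A (t s : R) : 0 < s <= 1 -> rcont (fun s => f (Gam s t) * / RtoC s)%C s.
Proof.
  intros Hs. unfold rcont. apply tends_mult.
  - apply (rcont_comp f (fun s => Gam s t)); [apply Hf, Gam_in; lra|apply rcont_Gam_s].
  - apply tends_inv.
    + apply Cmod_gt_neq0. rewrite Cmod_R, Rabs_pos_eq; lra.
    + apply (rcont_RtoC (fun u => u)). apply continuous_id.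
Qed.

Lemma rcont_fGam (s t : R) : 0 <= s <= 1 -> rcont (fun t => f (Gam s t)) t.
Proof.
  intros Hs. apply (rcont_comp f (fun t => Gam s t)); [now apply Hf, Gam_in|apply rcont_Gam_t].
Qed.

Lemma rcont_B (s t : R) : 0 <= s <= 1 -> rcont (fun t => Ci * k t * f (Gam s t))%C t.
Proof.
  intros Hs. unfold rcont. apply tends_mult.
  - apply tends_scal. now apply rcont_ckern.
  - now apply rcont_fGam.
Qed.

Lemma Gam_lipschitz (s t s' t' : R) : 0 <= s <= 1 ->
  Cmod (Gam s t - Gam s' t')%C <= 2 * rho * (Rabs (s - s') + Rabs (t - t')).
Proof.
  intros Hs. assert (P := rho_pos).
  replace (Gam s t - Gam s' t')%C with
    (RtoC s * (RtoC rho * (cis t - cis t')) + RtoC (s - s') * (circ rho t' - z))%C.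
  2: { unfold Gam, circ. rewrite RtoC_minus. ring. }
  eapply Rle_trans; [apply Cmod_triangle|].
  rewrite !Cmod_mult, !Cmod_R, (Rabs_pos_eq s), (Rabs_pos_eq rho) by lra.
  assert (H1 := cis_lipschitz t' t). assert (H2 := Cmod_tri_sub (circ rho t') z).
  rewrite Cmod_circ in H2 by lra.
  assert (H3 := Rabs_pos (s - s')). assert (H4 := Rabs_pos (t - t')).
  assert (H5 := Cmod_ge_0 (cis t - cis t')%C).
  assert (s * (rho * Cmod (cis t - cis t')%C) <= 1 * (rho * Rabs (t - t'))).
  { apply Rmult_le_compat; try nra. }
  assert (Rabs (s - s') * Cmod (circ rho t' - z)%C <= Rabs (s - s') * (2 * rho)).
  { apply Rmult_le_compat_l; lra. }
  nra.
Qed.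

Lemma Ci_mod : Cmod Ci = 1.
Proof.
  unfold Cmod, Ci; simpl. replace (0 * (0 * 1) + 1 * (1 * 1)) with 1 by ring. apply sqrt_1.
Qed.

(** The affine part of [f] at p = [Gam s t] has zero circulation. Pairing opposite edges, the
    constant [f p] cancels within each pair, and l (w - p) contributes l (s1 - s0)(circ t0 - circ
    t1) to one pair and its opposite to the other. Only the remainder [g] is left, and it is small
    compared with |w - p|. *)
Lemma form_closed_local (a s t eps : R) : 0 < a -> a <= s <= 1 -> 0 < eps ->
  exists del, 0 < del /\ forall s0 s1 t0 t1,
    a <= s0 -> s0 <= s <= s1 -> s1 <= 1 -> t0 <= t <= t1 ->
    s1 - s0 < del -> t1 - t0 < del ->
    Cmod (A t0 s0 s1 - A t1 s0 s1 + B s1 t0 t1 - B s0 t0 t1)%C <= eps * ((s1 - s0) + (t1 - t0)) ^ 2.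
Proof.
  intros Ha Hs He. assert (P := rho_pos). assert (PK := K_pos).
  assert (Pa : 0 < / a) by now apply Rinv_0_lt_compat.
  set (p := Gam s t). destruct (cdiff_approx f p) as [l Hl].
  { apply Hf, Gam_in. lra. }
  (* On the rectangle |g| <= e * 2 rho m. The horizontal pair is weighted by 1/u <= 1/a and the
     vertical one by |k| <= K, each over a length at most [m], for a total of e * 4 rho (1/a + K)
     m^2. *)
  set (e := eps / (4 * rho * (/ a + K))).
  assert (Pe : 0 < e) by (apply Rdiv_lt_0_compat; [lra|nra]).
  destruct (Hl e Pe) as [d [Hd Hg]].
  set (g := fun w => (f w - f p - l * (w - p))%C).
  (* [Gam] is Lipschitz with constant 2 rho, so two sides below d / (4 rho) keep the image within
     [d] of [p]. *)
  exists (d / (4 * rho)). split; [apply Rdiv_lt_0_compat; lra|].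
  intros s0 s1 t0 t1 H1 H2 H3 H4 H5 H6.
  set (m := (s1 - s0) + (t1 - t0)).
  assert (Hm : 0 <= m) by (unfold m; lra).
  assert (Hmd : 2 * rho * m < d).
  { replace d with (2 * rho * (d / (4 * rho) + d / (4 * rho))) by (field; lra).
    apply Rmult_lt_compat_l; unfold m; lra. }
  assert (Bg : forall u v, s0 <= u <= s1 -> t0 <= v <= t1 -> Cmod (g (Gam u v)) <= e * (2 * rho * m)).
  { intros u v Hu Hv.
    assert (D : Cmod (Gam u v - p)%C <= 2 * rho * m).
    { unfold p. eapply Rle_trans; [apply Gam_lipschitz; lra|].
      apply Rmult_le_compat_l; [lra|].
      assert (Rabs (u - s) <= s1 - s0) by (apply Rabs_le; lra).
      assert (Rabs (v - t) <= t1 - t0) by (apply Rabs_le; lra). unfold m; lra. }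
    eapply Rle_trans; [apply Hg; lra|]. apply Rmult_le_compat_l; lra. }
  assert (X : is_CI (fun u => (g (Gam u t0) - g (Gam u t1)) * / RtoC u)%C s0 s1
                (A t0 s0 s1 + (- RtoC 1) * A t1 s0 s1
                 + RtoC (s1 - s0) * (- (l * (circ rho t0 - circ rho t1))))%C).
  { apply is_CI_ext with (fun u => f (Gam u t0) * / RtoC u + - RtoC 1 * (f (Gam u t1) * / RtoC u)
                                   + - (l * (circ rho t0 - circ rho t1)))%C; [lra| |].
    - intros u Hu. unfold g, Gam. field. apply Cmod_gt_neq0. rewrite Cmod_R, Rabs_pos_eq; lra.
    - apply is_CI_plus; [apply is_CI_plus; [|apply is_CI_scal]|apply is_CI_const];
      apply is_CI_CI; try lra; intros u Hu; apply rcont_A; lra. }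
  assert (Y : is_CI (fun v => Ci * k v * (g (Gam s1 v) - g (Gam s0 v)))%C t0 t1
                (B s1 t0 t1 + (- RtoC 1) * B s0 t0 t1
                 + - (l * RtoC (s1 - s0) * RtoC rho) * (cis t1 - cis t0))%C).
  { apply is_CI_ext with (fun v => Ci * k v * f (Gam s1 v) + - RtoC 1 * (Ci * k v * f (Gam s0 v))
                                   + - (l * RtoC (s1 - s0) * RtoC rho) * (Ci * cis v))%C; [lra| |].
    - intros v Hv. unfold g, Gam, k, ckern. rewrite RtoC_minus.
      assert (N := circ_sub_neq_0 rho v z Hz). unfold circ in *. field. exact N.
    - apply is_CI_plus; [apply is_CI_plus; [|apply is_CI_scal]|apply is_CI_scal, is_CI_cis];
      apply is_CI_CI; try lra; intros v Hv; apply rcont_B; lra. }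
  apply (is_CI_norm_le_const _ _ _ (2 * (e * (2 * rho * m)) * / a)) in X; [|lra|].
  2: { intros u Hu. rewrite Cmod_mult, Cmod_inv, Cmod_R, Rabs_pos_eq;
       [|lra|apply Cmod_gt_neq0; rewrite Cmod_R, Rabs_pos_eq; lra].
       apply Rmult_le_compat; [apply Cmod_ge_0|apply Rlt_le, Rinv_0_lt_compat; lra| |].
       - eapply Rle_trans; [apply Cmod_tri_sub|].
         assert (Q1 := Bg u t0 Hu ltac:(lra)). assert (Q2 := Bg u t1 Hu ltac:(lra)). lra.
       - apply Rinv_le_contravar; lra. }
  apply (is_CI_norm_le_const _ _ _ (K * (2 * (e * (2 * rho * m))))) in Y; [|lra|].
  2: { intros v Hv. rewrite !Cmod_mult, Ci_mod, Rmult_1_l.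
       apply Rmult_le_compat; [apply Cmod_ge_0|apply Cmod_ge_0|now apply Cmod_ckern_le|].
       eapply Rle_trans; [apply Cmod_tri_sub|].
       assert (Q1 := Bg s0 v ltac:(lra) Hv). assert (Q2 := Bg s1 v ltac:(lra) Hv). lra. }
  match type of X with Cmod ?x <= _ => set (x0 := x) in * end.
  match type of Y with Cmod ?x <= _ => set (y0 := x) in * end.
  replace (A t0 s0 s1 - A t1 s0 s1 + B s1 t0 t1 - B s0 t0 t1)%C with (x0 + y0)%C.
  2: { unfold x0, y0, circ. ring. }
  eapply Rle_trans; [apply Cmod_triangle|].
  replace eps with (e * (4 * rho * (/ a + K))).
  2: { unfold e. assert (Pq : 0 < / a + K) by lra. revert Pq. generalize (/ a + K). intros q Pq.
       field. split; lra. }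
  replace (e * (4 * rho * (/ a + K)) * m ^ 2)
    with (2 * (e * (2 * rho * m)) * / a * m + K * (2 * (e * (2 * rho * m))) * m) by ring.
  assert (Pq : 0 <= 2 * (e * (2 * rho * m)))
    by (apply Rmult_le_pos; [lra|apply Rmult_le_pos; [lra|apply Rmult_le_pos; lra]]).
  apply Rplus_le_compat.
  - eapply Rle_trans; [exact X|]. apply Rmult_le_compat_l; [|unfold m; lra]. apply Rmult_le_pos; lra.
  - eapply Rle_trans; [exact Y|]. apply Rmult_le_compat_l; [|unfold m; lra]. apply Rmult_le_pos; lra.
Qed.

(** The edges t = 0 and t = 2 pi of the rectangle have the same image and cancel. Positivity of [a]
    avoids the pole of ds / s. *)
Lemma B_constant (a : R) : 0 < a < 1 -> B 1 0 (2 * PI) = B a 0 (2 * PI).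
Proof.
  intros Ha. assert (HP := PI_RGT_0).
  assert (G := goursat A B a 1 0 (2 * PI) ltac:(lra) ltac:(lra)).
  assert (E : (A 0 a 1 - A (2 * PI) a 1 + B 1 0 (2 * PI) - B a 0 (2 * PI))%C = RtoC 0).
  { apply G.
    - intros t s0 s1 s2 Ht H1 H2 H3 H4. apply CI_Chasles; auto. intros s Hs. apply rcont_A. lra.
    - intros s t0 t1 t2 Hs H1 H2 H3 H4. apply CI_Chasles; auto. intros t Ht. apply rcont_B. lra.
    - intros s t eps Hs Ht He. destruct (form_closed_local a s t eps) as [d [Hd H]]; [lra|lra|lra|].
      exists d. split; [exact Hd|]. intros. apply H; assumption. }
  assert (EA : A (2 * PI) a 1 = A 0 a 1).
  { unfold A, Gam, circ. now rewrite cis_period. }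
  rewrite EA in E.
  replace (B 1 0 (2 * PI)) with (B a 0 (2 * PI) + (A 0 a 1 - A 0 a 1 + B 1 0 (2 * PI) - B a 0 (2 * PI)))%C by ring.
  rewrite E. ring.
Qed.

(** The angular integral does not depend on [s], and as s -> 0 its integrand tends to i k(t) f(z)
    uniformly in [t]. The integral of the kernel is evaluated later, from the case z = 0 of this
    identity. *)
Lemma cauchy_unnormalized :
  CI (fun t => ckern rho z t * f (circ rho t))%C 0 (2 * PI) = (f z * CI (ckern rho z) 0 (2 * PI))%C.
Proof.
  change (CI (fun t => k t * f (circ rho t))%C 0 (2 * PI) = (f z * CI k 0 (2 * PI))%C).
  assert (HP := PI_RGT_0). assert (P := rho_pos). assert (PK := K_pos).
  apply Cmod_eq_sub_0. apply le_epsilon. intros eps He. rewrite Rplus_0_l.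
  set (e := eps / (K * (2 * PI))).
  assert (Pe : 0 < e) by (apply Rdiv_lt_0_compat; [lra|nra]).
  assert (Cz : tends (locC z) f (f z)) by (apply cdiff_tends, Hf; lra).
  destruct (proj1 (locally_Cmod _ _) (Cz e Pe)) as [d [Hd H]].
  (* Since |circ rho t - z| <= 2 rho, this puts every [Gam a t] within [d] of [z]; the bound 1/2
     keeps a < 1 for [B_constant]. *)
  set (a := Rmin (1 / 2) (d / (4 * rho))).
  assert (Ha : 0 < a) by (apply Rmin_pos; [lra|apply Rdiv_lt_0_compat; lra]).
  assert (Ha1 : a <= 1 / 2) by apply Rmin_l.
  assert (Ha2 : 2 * rho * a < d).
  { apply Rle_lt_trans with (2 * rho * (d / (4 * rho))).
    - apply Rmult_le_compat_l; [lra|apply Rmin_r].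
    - replace (2 * rho * (d / (4 * rho))) with (d / 2) by (field; lra). lra. }
  assert (B1 : B 1 0 (2 * PI) = (Ci * CI (fun t => k t * f (circ rho t)) 0 (2 * PI))%C).
  { apply is_CI_unique. apply is_CI_ext with (fun t => Ci * (k t * f (circ rho t)))%C; [lra| |].
    - intros t _. unfold Gam. replace (z + 1 * (circ rho t - z))%C with (circ rho t) by ring. ring.
    - apply is_CI_scal, is_CI_CI; [lra|]. intros t _. apply tends_mult; [now apply rcont_ckern|].
      apply rcont_comp; [apply Hf; rewrite Cmod_circ; lra|apply rcont_circ]. }
  assert (Q : is_CI (fun t => Ci * k t * (f (Gam a t) - f z))%C 0 (2 * PI)
     (B a 0 (2 * PI) + (- Ci * f z) * CI k 0 (2 * PI))%C).
  { apply is_CI_ext with (fun t => Ci * k t * f (Gam a t) + (- Ci * f z) * k t)%C; [lra| |].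
    - intros t _. ring.
    - apply is_CI_plus; [|apply is_CI_scal]; apply is_CI_CI; try lra; intros t _.
      + apply rcont_B. lra.
      + now apply rcont_ckern. }
  rewrite <- B_constant in Q by lra. rewrite B1 in Q.
  apply (is_CI_norm_le_const _ _ _ (K * e)) in Q; [|lra|].
  2: { intros t _. rewrite !Cmod_mult, Ci_mod, Rmult_1_l.
       apply Rmult_le_compat; [apply Cmod_ge_0|apply Cmod_ge_0|now apply Cmod_ckern_le|].
       apply Rlt_le, H. unfold Gam.
       replace (z + RtoC a * (circ rho t - z) - z)%C with (RtoC a * (circ rho t - z))%C by ring.
       rewrite Cmod_mult, Cmod_R, Rabs_pos_eq by lra.
       assert (T := Cmod_tri_sub (circ rho t) z). rewrite Cmod_circ in T by lra. nra. }
  replace (Ci * CI (fun t => k t * f (circ rho t)) 0 (2 * PI) + - Ci * f z * CI k 0 (2 * PI))%C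
    with (Ci * (CI (fun t => k t * f (circ rho t)) 0 (2 * PI) - f z * CI k 0 (2 * PI)))%C in Q by ring.
  rewrite Cmod_mult, Ci_mod, Rmult_1_l in Q.
  eapply Rle_trans; [exact Q|]. right. unfold e. field. split; lra.
Qed.
End CauchyFormula.

(** At z = 0 the kernel is identically 1, so its integral is known at once. This case then yields
    the integral of the kernel for every [z]. *)
Lemma mean_value (f : C -> C) (rho : R) : 0 < rho ->
  (forall w, Cmod w <= rho -> cdiff f w) ->
  is_CI (fun t => f (circ rho t)) 0 (2 * PI) (RtoC (2 * PI) * f (RtoC 0))%C.
Proof.
  intros Hr Hf. assert (HP := PI_RGT_0).
  assert (H0 : Cmod (RtoC 0) < rho) by (rewrite Cmod_0; lra).
  assert (E := cauchy_unnormalized f (RtoC 0) rho H0 Hf).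
  assert (Ek : forall t, ckern rho (RtoC 0) t = RtoC 1).
  { intros t. unfold ckern. assert (N := circ_sub_neq_0 rho t _ H0).
    replace (circ rho t - RtoC 0)%C with (circ rho t) in * by ring. now field. }
  assert (E1 : CI (ckern rho (RtoC 0)) 0 (2 * PI) = RtoC (2 * PI)).
  { apply is_CI_unique. apply is_CI_ext with (fun _ => RtoC 1); [lra|intros; now rewrite Ek|].
    replace (RtoC (2 * PI)) with (RtoC (2 * PI - 0) * RtoC 1)%C by (rewrite Rminus_0_r; ring).
    apply is_CI_const. }
  rewrite E1 in E. rewrite Cmult_comm, <- E.
  apply is_CI_ext with (fun t => ckern rho (RtoC 0) t * f (circ rho t))%C; [lra| |].
  - intros t _. rewrite Ek. ring.
  - apply is_CI_CI; [lra|]. intros t _. apply tends_mult; [now apply rcont_ckern|].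
    apply rcont_comp; [apply Hf; rewrite Cmod_circ; lra|apply rcont_circ].
Qed.

Lemma cconj_cis (t : R) : (Cconj (cis t) * cis t)%C = RtoC 1.
Proof.
  unfold Cconj, cis, Cmult, RtoC; simpl. assert (H := sin2_cos2 t). unfold Rsqr in H.
  f_equal; [lra|ring].
Qed.

Lemma Cconj_R (x : R) : Cconj (RtoC x) = RtoC x.
Proof. unfold Cconj, RtoC; simpl. f_equal. ring. Qed.

(* On the circle the conjugate of the Cauchy kernel extends holomorphically to the disk. *)
Lemma CI_ckern (rho : R) (z : C) : Cmod z < rho -> CI (ckern rho z) 0 (2 * PI) = RtoC (2 * PI).
Proof.
  intros Hz. assert (P := Cmod_ge_0 z). assert (HP := PI_RGT_0).
  (* Obtained by substituting conj ζ = rho^2 / ζ into the conjugate of ζ / (ζ - z). Its value at 0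
     is 1. *)
  set (h := fun w => (RtoC rho / (RtoC rho - Cconj z * w / RtoC rho))%C).
  assert (Nr : RtoC rho <> RtoC 0) by (apply Cmod_gt_neq0; rewrite Cmod_R, Rabs_pos_eq; lra).
  assert (D : forall w, Cmod w <= rho -> (RtoC rho - Cconj z * w / RtoC rho)%C <> RtoC 0).
  { intros w Hw. apply Cmod_gt_neq0. eapply Rlt_le_trans; [|apply Cmod_ge_sub].
    rewrite Cmod_div, Cmod_mult, Cmod_conj, Cmod_R, Rabs_pos_eq by (auto; lra).
    apply Rlt_le_trans with (rho - Cmod z); [lra|]. apply Rplus_le_compat_l, Ropp_le_contravar.
    apply Rmult_le_reg_r with rho; [lra|]. unfold Rdiv. rewrite Rmult_assoc, Rinv_l by lra. nra. }
  assert (M : is_CI (fun t => h (circ rho t)) 0 (2 * PI) (RtoC (2 * PI) * h (RtoC 0))%C).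
  { apply mean_value; [lra|]. intros w Hw. unfold h. apply cdiff_div; [now apply D|apply cdiff_const|].
    apply cdiff_minus; [apply cdiff_const|]. apply cdiff_div; [exact Nr| |apply cdiff_const].
    apply cdiff_scal, cdiff_id. }
  apply is_CI_conj in M. apply is_CI_unique.
  replace (Cconj (RtoC (2 * PI) * h (RtoC 0)))%C with (RtoC (2 * PI)) in M.
  2: { unfold h. replace (RtoC rho / (RtoC rho - Cconj z * 0 / RtoC rho))%C with (RtoC 1).
       - unfold Cconj, Cmult, RtoC; simpl. f_equal; ring.
       - replace (RtoC rho - Cconj z * 0 / RtoC rho)%C with (RtoC rho) by now field. now field. }
  revert M. apply is_CI_ext; [lra|]. intros t _.
  assert (Dt := D (circ rho t) ltac:(rewrite Cmod_circ; lra)).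
  unfold h, ckern. assert (N := circ_sub_neq_0 rho t z Hz).
  rewrite Cdiv_conj by exact Dt. rewrite Cminus_conj, Cdiv_conj, Cmult_conj, Cconj_conj, !Cconj_R by exact Nr.
  unfold circ in *. rewrite Cmult_conj, Cconj_R.
  assert (U := cconj_cis t).
  replace (RtoC rho - z * (RtoC rho * Cconj (cis t)) / RtoC rho)%C
    with ((RtoC rho * cis t - z) * Cconj (cis t))%C.
  2: { replace ((RtoC rho * cis t - z) * Cconj (cis t))%C
        with (RtoC rho * (Cconj (cis t) * cis t) - z * Cconj (cis t))%C by ring.
       rewrite U. now field. }
  assert (Nc : Cconj (cis t) <> RtoC 0) by (apply Cmod_gt_neq0; rewrite Cmod_conj, Cmod_cis; lra).
  replace (RtoC rho * cis t / (RtoC rho * cis t - z))%C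
    with (RtoC rho * (Cconj (cis t) * cis t) / ((RtoC rho * cis t - z) * Cconj (cis t)))%C by (field; auto).
  rewrite U. f_equal. ring.
Qed.

Lemma cauchy_formula (f : C -> C) (rho : R) (z : C) : Cmod z < rho ->
  (forall w, Cmod w <= rho -> cdiff f w) ->
  is_CI (fun t => ckern rho z t * f (circ rho t))%C 0 (2 * PI) (RtoC (2 * PI) * f z)%C.
Proof.
  intros Hz Hf. assert (P := Cmod_ge_0 z). assert (HP := PI_RGT_0).
  assert (E := cauchy_unnormalized f z rho Hz Hf). rewrite CI_ckern in E by exact Hz.
  rewrite Cmult_comm, <- E. apply is_CI_CI; [lra|].
  intros t _. apply tends_mult; [now apply rcont_ckern|].
  apply rcont_comp; [apply Hf; rewrite Cmod_circ; lra|apply rcont_circ].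
Qed.

(** * Schwarz lemma and the Caratheodory class *)

(** The Cauchy transform of a boundary density, without 1 / (2 pi). The density need not come from
    an analytic function: this produces the value of phi(z)/z at 0 and the analyticity of locally
    uniform limits. *)
Definition cauchy_int (rho : R) (h : R -> C) (w : C) : C :=
  CI (fun t => ckern rho w t * h t)%C 0 (2 * PI).

Lemma is_CI_cauchy_int (rho : R) (h : R -> C) (w : C) :
  Cmod w < rho -> (forall t, 0 <= t <= 2 * PI -> rcont h t) ->
  is_CI (fun t => ckern rho w t * h t)%C 0 (2 * PI) (cauchy_int rho h w).
Proof.
  intros Hw Hh. assert (HP := PI_RGT_0). apply is_CI_CI; [lra|]. intros t Ht.
  apply tends_mult; [now apply rcont_ckern|now apply Hh].
Qed.

Lemma cauchy_int_bound (rho M : R) (h : R -> C) (w : C) :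
  Cmod w < rho -> (forall t, 0 <= t <= 2 * PI -> rcont h t) ->
  (forall t, 0 <= t <= 2 * PI -> Cmod (h t) <= M) ->
  Cmod (cauchy_int rho h w) <= rho / (rho - Cmod w) * M * (2 * PI).
Proof.
  intros Hw Hh HM. assert (HP := PI_RGT_0).
  rewrite <- (Rminus_0_r (2 * PI)).
  apply (is_CI_norm_le_const _ _ _ _ _) with (3 := is_CI_cauchy_int rho h w Hw Hh); [lra|].
  intros t Ht. rewrite Cmod_mult.
  apply Rmult_le_compat; [apply Cmod_ge_0|apply Cmod_ge_0|now apply Cmod_ckern_le|now apply HM].
Qed.

Lemma rcont_div_circ_sub (rho : R) (h : R -> C) (z : C) (t : R) :
  Cmod z < rho -> rcont h t -> rcont (fun t => h t / (circ rho t - z))%C t.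
Proof.
  intros Hz Hh. apply tends_mult; [exact Hh|]. apply tends_inv; [now apply circ_sub_neq_0|].
  apply tends_minus; [apply rcont_circ|apply tends_const].
Qed.

Lemma Cmod_div_circ_sub (rho M : R) (h : R -> C) (z : C) (t : R) :
  Cmod z < rho -> Cmod (h t) <= M -> Cmod (h t / (circ rho t - z))%C <= M / (rho - Cmod z).
Proof.
  intros Hz HM. assert (P := Cmod_ge_0 z). rewrite Cmod_div by now apply circ_sub_neq_0.
  assert (K := circ_sub_ge rho t z).
  apply Rmult_le_compat; [apply Cmod_ge_0|apply Rlt_le, Rinv_0_lt_compat; lra|exact HM|].
  apply Rinv_le_contravar; lra.
Qed.

(** The kernels satisfy ckern w - ckern z = (w - z) ckern w / (ζ - z), so the difference quotient is
    exactly another Cauchy transform. Its continuity follows by using the identity once more, with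
    no differentiation under the integral. *)
Lemma cauchy_int_increment (rho : R) (h : R -> C) (z w : C) :
  Cmod z < rho -> Cmod w < rho -> (forall t, 0 <= t <= 2 * PI -> rcont h t) ->
  cauchy_int rho h w =
    (cauchy_int rho h z + cauchy_int rho (fun t => h t / (circ rho t - z)) w * (w - z))%C.
Proof.
  intros Hz Hw Hh. assert (HP := PI_RGT_0).
  apply is_CI_unique.
  apply is_CI_ext with (fun t => ckern rho z t * h t + (w - z) * (ckern rho w t * (h t / (circ rho t - z))))%C; [lra| |].
  - intros t _. assert (N1 := circ_sub_neq_0 rho t z Hz). assert (N2 := circ_sub_neq_0 rho t w Hw).
    unfold ckern. field. auto.
  - rewrite (Cmult_comm _ (w - z)%C). apply is_CI_plus; [now apply is_CI_cauchy_int|].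
    apply is_CI_scal, is_CI_cauchy_int; auto. intros t Ht. now apply rcont_div_circ_sub, Hh.
Qed.

Lemma locally_Cmod_lt (z : C) (r : R) : Cmod z < r -> locC z (fun w => Cmod w < r).
Proof.
  intros H. apply locally_Cmod. exists (r - Cmod z). split; [lra|].
  intros w Hw. assert (K := Cmod_le_via w z). lra.
Qed.

Lemma cdiff_cauchy_int (rho M : R) (h : R -> C) (z : C) :
  Cmod z < rho -> (forall t, 0 <= t <= 2 * PI -> rcont h t) ->
  (forall t, 0 <= t <= 2 * PI -> Cmod (h t) <= M) ->
  cdiff (cauchy_int rho h) z.
Proof.
  intros Hz Hh HM. assert (HP := PI_RGT_0). assert (P := Cmod_ge_0 z).
  set (h1 := fun t => (h t / (circ rho t - z))%C).
  assert (Hh1 : forall t, 0 <= t <= 2 * PI -> rcont h1 t).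
  { intros t Ht. now apply rcont_div_circ_sub, Hh. }
  set (h2 := fun t => (h1 t / (circ rho t - z))%C).
  assert (Hh2 : forall t, 0 <= t <= 2 * PI -> rcont h2 t).
  { intros t Ht. now apply rcont_div_circ_sub, Hh1. }
  set (M2 := M / (rho - Cmod z) / (rho - Cmod z)).
  assert (HM2 : forall t, 0 <= t <= 2 * PI -> Cmod (h2 t) <= M2).
  { intros t Ht. apply Cmod_div_circ_sub; [exact Hz|]. apply Cmod_div_circ_sub; auto. }
  assert (PM2 : 0 <= M2).
  { apply Rle_trans with (2 := HM2 0 ltac:(lra)). apply Cmod_ge_0. }
  exists (cauchy_int rho h1), (cauchy_int rho h1 z). split.
  (* Halfway between |z| and rho: for |w| < r' the kernel has the common bound rho / (rho - r'). *)
  - set (r' := (rho + Cmod z) / 2).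
    set (Q := rho / (rho - r') * M2 * (2 * PI)).
    assert (HQ : 0 <= Q).
    { unfold Q. apply Rmult_le_pos; [|lra]. apply Rmult_le_pos; [|lra].
      apply Rlt_le, Rdiv_lt_0_compat; unfold r'; lra. }
    intros eps He.
    assert (L : locC z (fun w => Cmod (w - z)%C < eps / (Q + 1))).
    { apply locally_Cmod. exists (eps / (Q + 1)). split; [apply Rdiv_lt_0_compat; lra|auto]. }
    assert (Hr' : Cmod z < r') by (unfold r'; lra).
    generalize (filter_and _ _ L (locally_Cmod_lt z r' Hr')). apply filter_imp. intros w [H1 H2].
    assert (Hw : Cmod w < rho) by (unfold r' in H2; lra).
    rewrite (cauchy_int_increment rho h1 z w) by auto. fold h2.
    replace (cauchy_int rho h1 z + cauchy_int rho h2 w * (w - z) - cauchy_int rho h1 z)%C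
      with (cauchy_int rho h2 w * (w - z))%C by cring.
    rewrite Cmod_mult.
    assert (B : Cmod (cauchy_int rho h2 w) <= Q).
    { eapply Rle_trans; [apply (cauchy_int_bound rho M2); auto|].
      apply Rmult_le_compat_r; [lra|]. apply Rmult_le_compat_r; [lra|].
      apply Rmult_le_compat_l; [lra|]. apply Rinv_le_contravar; unfold r' in *; lra. }
    assert (P1 := Cmod_ge_0 (w - z)%C).
    apply Rle_lt_trans with (Q * Cmod (w - z)%C); [now apply Rmult_le_compat_r|].
    apply Rle_lt_trans with ((Q + 1) * Cmod (w - z)%C); [nra|].
    replace eps with ((Q + 1) * (eps / (Q + 1))) by (field; lra).
    apply Rmult_lt_compat_l; lra.
  - generalize (locally_Cmod_lt z rho Hz). apply filter_imp. intros w Hw.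
    now apply cauchy_int_increment.
Qed.

(** * Maximum principle, Schwarz and Schwarz-Pick lemmas *)

Lemma pow_dominated (x M K : R) : 0 <= M -> (forall n, x ^ n <= K * M ^ n) -> x <= M.
Proof.
  intros HM H. destruct (Rle_dec x M) as [L|N]; [exact L|exfalso].
  destruct (Req_dec M 0) as [E|N0].
  - specialize (H 1%nat). simpl in H. rewrite E in *. lra.
  - assert (Hx : 1 < x / M).
    { apply Rmult_lt_reg_r with M; [lra|]. unfold Rdiv. rewrite Rmult_assoc, Rinv_l; lra. }
    destruct (Pow_x_infinity (x / M) ltac:(rewrite Rabs_pos_eq; lra) (K + 1)) as [n Hn].
    specialize (Hn n (le_n n)). specialize (H n).
    assert (P : 0 < M ^ n) by (apply pow_lt; lra).
    rewrite Rabs_pos_eq in Hn by (apply pow_le; lra).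
    assert (E : x ^ n = (x / M) ^ n * M ^ n).
    { rewrite <- Rpow_mult_distr. f_equal. field. exact N0. }
    rewrite E in H. nra.
Qed.

Lemma Cmod_pow (z : C) (n : nat) : Cmod (Cpow z n) = Cmod z ^ n.
Proof.
  induction n as [|n IH]; simpl; [apply Cmod_1|]. now rewrite Cmod_mult, IH.
Qed.

(* Cauchy's formula bounds [g z] up to a constant factor; applying it to [g ^ n] removes the factor. *)
Lemma max_principle (g : C -> C) (rho M : R) (z : C) : Cmod z < rho ->
  (forall w, Cmod w <= rho -> cdiff g w) ->
  (forall t, Cmod (g (circ rho t)) <= M) -> Cmod (g z) <= M.
Proof.
  intros Hz Hg HM. assert (HP := PI_RGT_0). assert (P := Cmod_ge_0 z).
  apply pow_dominated with (rho / (rho - Cmod z)).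
  { apply Rle_trans with (2 := HM 0). apply Cmod_ge_0. }
  intros n.
  assert (E := cauchy_formula (fun w => Cpow (g w) n) rho z Hz (fun w Hw => cdiff_pow g w n (Hg w Hw))).
  apply (is_CI_norm_le_const _ _ _ (rho / (rho - Cmod z) * M ^ n)) in E; [|lra|].
  - rewrite Cmod_mult, Cmod_R, Cmod_pow, Rabs_pos_eq in E by lra. nra.
  - intros t _. rewrite Cmod_mult, Cmod_pow.
    apply Rmult_le_compat; [apply Cmod_ge_0|apply pow_le, Cmod_ge_0|now apply Cmod_ckern_le|].
    apply pow_incr. split; [apply Cmod_ge_0|apply HM].
Qed.

Lemma le_of_scaled (x y : R) : (forall s, 0 < s < 1 -> s * x <= y) -> x <= y.
Proof.
  intros H. destruct (Rle_dec x y) as [L|N]; [exact L|exfalso].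
  assert (H1 := H (1/2) ltac:(lra)).
  destruct (Rle_dec x 0) as [L|N'].
  - lra.
  - assert (Hy : y < 1 * x) by lra.
    assert (Q : y / x < 1). { apply Rmult_lt_reg_r with x; [lra|]. unfold Rdiv. rewrite Rmult_assoc, Rinv_l; lra. }
    destruct (Rle_dec (y / x) 0) as [L2|N2].
    + assert (y = y / x * x) by (field; lra). nra.
    + specialize (H ((1 + y / x) / 2) ltac:(lra)). assert (y = y / x * x) by (field; lra). nra.
Qed.

(** The singularity of phi(w)/w at 0 is removed by the Cauchy transform of its values on |ζ| = 1/2.
    The maximum principle on circles of radius rho < 1 bounds the quotient by 1/rho, and rho -> 1
    gives 1. *)
Lemma schwarz_factor (phi : C -> C) :
  (forall z, inD z -> cdiff phi z) -> (forall z, inD z -> Cmod (phi z) <= 1) -> phi (RtoC 0) = RtoC 0 ->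
  exists psi : C -> C, (forall z, inD z -> cdiff psi z) /\ (forall z, inD z -> Cmod (psi z) <= 1) /\
    (forall z, inD z -> phi z = (z * psi z)%C).
Proof.
  intros Hd Hb H0. assert (HP := PI_RGT_0).
  set (h := fun t => (phi (circ (1/2) t) / circ (1/2) t)%C).
  set (I := fun w => (/ RtoC (2 * PI) * cauchy_int (1/2) h w)%C).
  assert (N2 : RtoC (2 * PI) <> RtoC 0) by (apply Cmod_gt_neq0; rewrite Cmod_R, Rabs_pos_eq; lra).
  assert (Nc : forall t, circ (1/2) t <> RtoC 0) by (intros t; apply Cmod_gt_neq0; rewrite Cmod_circ; lra).
  assert (Hph : forall t, rcont (fun t => phi (circ (1/2) t)) t).
  { intros t. apply rcont_comp; [apply Hd; unfold inD; rewrite Cmod_circ; lra|apply rcont_circ]. }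
  assert (Hh : forall t, 0 <= t <= 2 * PI -> rcont h t).
  { intros t _. apply tends_mult; [apply Hph|]. apply tends_inv; [apply Nc|apply rcont_circ]. }
  (* Partial fractions: ckern w / ζ = (ckern w - 1) / w. The first term is Cauchy's formula at [w],
     and the second is the mean value [phi 0 = 0]. *)
  assert (HI : forall w, w <> RtoC 0 -> Cmod w < 1/2 -> I w = (phi w / w)%C).
  { intros w Nw Hw. unfold I.
    assert (E : is_CI (fun t => ckern (1/2) w t * h t)%C 0 (2 * PI)
                  (/ w * (RtoC (2 * PI) * phi w + - RtoC 1 * (RtoC (2 * PI) * phi (RtoC 0))))%C).
    { apply is_CI_ext with (fun t => / w * (ckern (1/2) w t * phi (circ (1/2) t)
                                     + - RtoC 1 * phi (circ (1/2) t)))%C; [lra| |].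
      - intros t _. unfold h, ckern. assert (N1 := circ_sub_neq_0 (1/2) t w Hw). specialize (Nc t).
        field. auto.
      - apply is_CI_scal, is_CI_plus; [|apply is_CI_scal].
        + apply cauchy_formula; auto. intros v Hv. apply Hd. unfold inD. lra.
        + apply mean_value; [lra|]. intros v Hv. apply Hd. unfold inD. lra. }
    unfold cauchy_int. rewrite (is_CI_unique _ _ _ _ E), H0. field. auto. }
  set (psi := fun w => match excluded_middle_informative (@eq C w (RtoC 0)) with
                       | left _ => I (RtoC 0) | right _ => (phi w / w)%C end).
  assert (Dpsi : forall z, inD z -> cdiff psi z).
  { intros z Hz. destruct (classic (z = RtoC 0)) as [->|N].
    - apply cdiff_ext with I.
      + generalize (locally_Cmod_lt (RtoC 0) (1/2) ltac:(rewrite Cmod_0; lra)).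
        apply filter_imp. intros w Hw. unfold psi.
        destruct (excluded_middle_informative (@eq C w (RtoC 0))) as [->|Nw]; [reflexivity|now apply HI].
      + apply cdiff_scal. apply cdiff_cauchy_int with 2; [rewrite Cmod_0; lra|exact Hh|].
        intros t _. unfold h. rewrite Cmod_div by apply Nc. rewrite Cmod_circ by lra.
        assert (B := Hb (circ (1/2) t) ltac:(unfold inD; rewrite Cmod_circ; lra)). lra.
    - apply cdiff_ext with (fun w => phi w / w)%C.
      + assert (P := proj1 (Cmod_gt_0 _) N). apply locally_Cmod. exists (Cmod z). split; [exact P|].
        intros w Hw. unfold psi. destruct (excluded_middle_informative (@eq C w (RtoC 0))) as [E|Nw]; [|reflexivity].
        exfalso. rewrite E in Hw. rewrite Cmod_sub_sym in Hw.
        replace (z - RtoC 0)%C with z in Hw by ring. lra.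
      + apply cdiff_div; [exact N|now apply Hd|apply cdiff_id]. }
  assert (Fac : forall z, phi z = (z * psi z)%C).
  { intros z. unfold psi. destruct (excluded_middle_informative (z = RtoC 0)) as [->|Nw].
    - rewrite H0. ring.
    - field. exact Nw. }
  exists psi. split; [exact Dpsi|]. split; [|intros z _; apply Fac].
  intros z Hz. unfold inD in Hz. assert (P := Cmod_ge_0 z).
  apply le_of_scaled. intros s Hs.
  (* This radius exceeds both |z| and [s], so |psi z| <= 1/rho implies s |psi z| <= 1. *)
  set (rho := Cmod z + (1 - Cmod z) * s).
  assert (H1 : Cmod z < rho < 1) by (unfold rho; nra).
  assert (H2 : s <= rho) by (unfold rho; nra).
  assert (B : Cmod (psi z) <= / rho).
  { apply (max_principle psi rho); [lra| |].
    - intros w Hw. apply Dpsi. unfold inD. lra.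
    - intros t. assert (Hc : Cmod (circ rho t) = rho) by (apply Cmod_circ; lra).
      assert (Bt := Hb (circ rho t) ltac:(unfold inD; lra)).
      rewrite Fac, Cmod_mult, Hc in Bt.
      apply Rmult_le_reg_l with rho; [lra|]. rewrite Rinv_r; lra. }
  assert (Pp := Cmod_ge_0 (psi z)).
  apply Rle_trans with (rho * Cmod (psi z)); [nra|].
  apply Rle_trans with (rho * / rho); [apply Rmult_le_compat_l; lra|]. rewrite Rinv_r; lra.
Qed.

Lemma schwarz_lemma (phi : C -> C) (z : C) :
  (forall z, inD z -> cdiff phi z) -> (forall z, inD z -> Cmod (phi z) <= 1) -> phi (RtoC 0) = RtoC 0 ->
  inD z -> Cmod (phi z) <= Cmod z.
Proof.
  intros Hd Hb H0 Hz. destruct (schwarz_factor phi Hd Hb H0) as [psi [_ [Hp Hf]]].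
  rewrite Hf by exact Hz. rewrite Cmod_mult. specialize (Hp z Hz). assert (P := Cmod_ge_0 z). nra.
Qed.

(** It shows that Moebius quotients are bounded by 1, and it converts a Schwarz-Pick estimate into a
    lower bound for 1 - |x|^2. *)
Lemma pseudo_hyp_identity (a x : C) :
  Cmod (1 - Cconj a * x)%C * Cmod (1 - Cconj a * x)%C - Cmod (x - a)%C * Cmod (x - a)%C =
  (1 - Cmod a * Cmod a) * (1 - Cmod x * Cmod x).
Proof.
  rewrite !Cmod_sqr. destruct a as [a1 a2], x as [x1 x2]. unfold Re, Im; simpl. ring.
Qed.

Lemma Cmod_le_of_sqr (x y : C) : Cmod x * Cmod x <= Cmod y * Cmod y -> Cmod x <= Cmod y.
Proof. intros H. assert (P1 := Cmod_ge_0 x). assert (P2 := Cmod_ge_0 y). nra. Qed.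

(* The Schwarz lemma for [(s psi - s a) / (1 - s^2 conj(a) psi)], [s < 1]; letting [s -> 1] covers [|a| = 1]. *)
Lemma schwarz_pick_origin (psi : C -> C) (z : C) :
  (forall z, inD z -> cdiff psi z) -> (forall z, inD z -> Cmod (psi z) <= 1) -> inD z ->
  Cmod (psi z - psi (RtoC 0))%C <= Cmod z * Cmod (1 - Cconj (psi (RtoC 0)) * psi z)%C.
Proof.
  intros Hd Hb Hz. set (a := psi (RtoC 0)).
  assert (Ha : Cmod a <= 1) by (apply Hb; unfold inD; rewrite Cmod_0; lra).
  assert (Pa := Cmod_ge_0 a). assert (Pz := Cmod_ge_0 z).
  set (D := Cmod (1 - Cconj a * psi z)%C). assert (PD := Cmod_ge_0 (1 - Cconj a * psi z)%C). fold D in PD.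
  assert (Main : forall s, 0 < s < 1 -> s * Cmod (psi z - a)%C <= Cmod z * (D + (1 - s * s))).
  { intros s Hs.
    set (den := fun w => (1 - Cconj (RtoC s * a) * (RtoC s * psi w))%C).
    assert (Bs : forall x, Cmod x <= 1 -> Cmod (RtoC s * x)%C <= s).
    { intros x Hx. rewrite Cmod_mult, Cmod_R, Rabs_pos_eq by lra. assert (P := Cmod_ge_0 x). nra. }
    assert (Nden : forall w, inD w -> den w <> RtoC 0).
    { intros w Hw. apply Cmod_gt_neq0. unfold den. eapply Rlt_le_trans; [|apply Cmod_ge_sub].
      rewrite Cmod_1, Cmod_mult, Cmod_conj.
      assert (B1 := Bs a Ha). assert (B2 := Bs (psi w) (Hb w Hw)).
      assert (P1 := Cmod_ge_0 (RtoC s * a)%C). assert (P2 := Cmod_ge_0 (RtoC s * psi w)%C). nra. }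
    assert (S := schwarz_lemma (fun w => (RtoC s * psi w - RtoC s * a) / den w)%C z).
    assert (S' : Cmod ((RtoC s * psi z - RtoC s * a) / den z)%C <= Cmod z).
    { apply S; auto.
      - intros w Hw. apply cdiff_div; [now apply Nden| |].
        + apply cdiff_minus; [apply cdiff_scal, Hd, Hw|apply cdiff_const].
        + apply cdiff_minus; [apply cdiff_const|]. apply cdiff_scal, cdiff_scal, Hd, Hw.
      - intros w Hw. rewrite Cmod_div by now apply Nden.
        assert (Pd := proj1 (Cmod_gt_0 _) (Nden w Hw)).
        apply Rmult_le_reg_r with (Cmod (den w)); [exact Pd|].
        unfold Rdiv. rewrite Rmult_assoc, Rinv_l, Rmult_1_r, Rmult_1_l by lra.
        apply Cmod_le_of_sqr. assert (E := pseudo_hyp_identity (RtoC s * a)%C (RtoC s * psi w)%C).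
        fold (den w) in E.
        assert (B1 := Bs a Ha). assert (B2 := Bs (psi w) (Hb w Hw)).
        assert (P1 := Cmod_ge_0 (RtoC s * a)%C). assert (P2 := Cmod_ge_0 (RtoC s * psi w)%C).
        assert (0 <= (1 - Cmod (RtoC s * a)%C * Cmod (RtoC s * a)%C) * (1 - Cmod (RtoC s * psi w)%C * Cmod (RtoC s * psi w)%C)).
        { apply Rmult_le_pos; nra. }
        lra.
      - fold a. replace (RtoC s * a - RtoC s * a)%C with (RtoC 0) by ring. unfold Cdiv. ring. }
    clear S. rewrite Cmod_div in S' by now apply Nden.
    assert (Pd := proj1 (Cmod_gt_0 _) (Nden z Hz)).
    assert (S2 : Cmod (RtoC s * psi z - RtoC s * a)%C <= Cmod z * Cmod (den z)).
    { replace (Cmod (RtoC s * psi z - RtoC s * a)%C) with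
        (Cmod (RtoC s * psi z - RtoC s * a)%C / Cmod (den z) * Cmod (den z)) by (field; lra).
      apply Rmult_le_compat_r; lra. }
    replace (RtoC s * psi z - RtoC s * a)%C with (RtoC s * (psi z - a))%C in S2 by ring.
    rewrite Cmod_mult, Cmod_R, Rabs_pos_eq in S2 by lra.
    eapply Rle_trans; [exact S2|]. apply Rmult_le_compat_l; [lra|].
    replace (den z) with ((1 - Cconj a * psi z) + RtoC (1 - s * s) * (Cconj a * psi z))%C.
    2: { unfold den. rewrite Cmult_conj, Cconj_R, RtoC_minus, RtoC_mult. ring. }
    eapply Rle_trans; [apply Cmod_triangle|]. fold D.
    apply Rplus_le_compat_l. rewrite !Cmod_mult, Cmod_conj, Cmod_R, Rabs_pos_eq by nra.
    specialize (Hb z Hz). assert (Pp := Cmod_ge_0 (psi z)).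
    assert (Cmod a * Cmod (psi z) <= 1) by nra. assert (0 <= 1 - s * s) by nra. nra. }
  apply le_epsilon. intros eps He.
  set (X := Cmod (psi z - a)%C). assert (PX := Cmod_ge_0 (psi z - a)%C). fold X in PX.
  set (m := Rmin (1/2) (eps / (X + 3))).
  assert (Hm : 0 < m) by (apply Rmin_pos; [lra|apply Rdiv_lt_0_compat; lra]).
  assert (Hm1 : m <= 1/2) by apply Rmin_l.
  assert (Hm2 : m * (X + 3) <= eps).
  { apply Rle_trans with (eps / (X + 3) * (X + 3)); [apply Rmult_le_compat_r; [lra|apply Rmin_r]|].
    right. field. lra. }
  specialize (Main (1 - m) ltac:(lra)). fold X in Main. unfold inD in Hz. nra.
Qed.

(** With phi = z psi and a = psi(0): if |a| = 1, the pseudo-hyperbolic identity gives |1 - conj(a)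
    psi| = |psi - a|, so Schwarz-Pick forces psi = a and phi is a rotation. If |a| < 1, |psi| is
    bounded away from 1 on |z| <= r. *)
Lemma not_rotation_contracts (phi : C -> C) (r : R) :
  schwarz_type phi -> ~ is_rotation phi -> 0 <= r < 1 ->
  exists c, 0 <= c < 1 /\ forall z, Cmod z <= r -> Cmod (phi z) <= c * Cmod z.
Proof.
  intros [Ha [Hb H0]] Hrot Hr.
  destruct (schwarz_factor phi) as [psi [Dp [Bp Fp]]]; auto.
  { intros z Hz. apply ex_derive_cdiff, Ha, Hz. }
  { intros z Hz. apply Rlt_le, Hb, Hz. }
  set (a := psi (RtoC 0)).
  assert (Ha1 : Cmod a <= 1) by (apply Bp; unfold inD; rewrite Cmod_0; lra).
  assert (Pa := Cmod_ge_0 a).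
  assert (Pick := fun z => schwarz_pick_origin psi z Dp Bp). fold a in Pick.
  destruct (Req_dec (Cmod a) 1) as [E|N].
  - exfalso. apply Hrot. exists a. split; [exact E|]. intros z Hz.
    assert (K := Pick z Hz). rewrite Fp by exact Hz.
    assert (EQ := pseudo_hyp_identity a (psi z)). rewrite E in EQ.
    assert (P1 := Cmod_ge_0 (psi z - a)%C). assert (P2 := Cmod_ge_0 (1 - Cconj a * psi z)%C).
    assert (E2 : Cmod (1 - Cconj a * psi z)%C = Cmod (psi z - a)%C) by nra.
    rewrite E2 in K. unfold inD in Hz.
    assert (Z : Cmod (psi z - a)%C <= 0) by nra.
    apply Cmod_eq_sub_0 in Z. rewrite Z. ring.
  (* With Y = |1 - conj(a) psi| and X = |psi - a| <= r Y, the identity gives (1 - |a|^2)(1 -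
     |psi|^2) = Y^2 - X^2 >= (1 - r^2) Y^2, and Y >= 1 - |a|. Hence 1 - |psi|^2 >= del. *)
  - set (del := (1 - r * r) * ((1 - Cmod a) * (1 - Cmod a))).
    assert (Hdel : 0 < del <= 1).
    { unfold del. assert (0 < 1 - r * r <= 1) by nra. assert (0 < (1 - Cmod a) * (1 - Cmod a) <= 1) by nra. split; [apply Rmult_lt_0_compat; lra|].
      apply Rle_trans with (1 * 1); [apply Rmult_le_compat; lra|lra]. }
    assert (Hs : 0 <= sqrt (1 - del) < 1).
    { split; [apply sqrt_pos|]. rewrite <- sqrt_1 at 2. apply sqrt_lt_1; lra. }
    exists (sqrt (1 - del)). split; [exact Hs|]. intros z Hz.
    assert (HzD : inD z) by (unfold inD; lra).
    rewrite (Fp z HzD), Cmod_mult, Rmult_comm. apply Rmult_le_compat_r; [apply Cmod_ge_0|].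
    assert (K := Pick z HzD). assert (EQ := pseudo_hyp_identity a (psi z)).
    assert (B := Bp z HzD). assert (Pp := Cmod_ge_0 (psi z)). assert (Pz := Cmod_ge_0 z).
    assert (P1 := Cmod_ge_0 (psi z - a)%C).
    assert (L : 1 - Cmod a <= Cmod (1 - Cconj a * psi z)%C).
    { eapply Rle_trans; [|apply Cmod_ge_sub]. rewrite Cmod_1, Cmod_mult, Cmod_conj. nra. }
    set (Y := Cmod (1 - Cconj a * psi z)%C) in *. set (X := Cmod (psi z - a)%C) in *.
    assert (KX : X * X <= (r * Y) * (r * Y)).
    { apply Rmult_le_compat; auto; (eapply Rle_trans; [exact K|]; apply Rmult_le_compat_r; lra). }
    assert (L2 : (1 - Cmod a) * (1 - Cmod a) <= Y * Y) by (apply Rmult_le_compat; lra).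
    assert (Q : del <= 1 - Cmod (psi z) * Cmod (psi z)).
    { assert (0 < 1 - r * r) by nra.
      assert (del <= (1 - r * r) * (Y * Y)) by (apply Rmult_le_compat_l; lra).
      assert (0 <= Cmod a * Cmod a * (1 - Cmod (psi z) * Cmod (psi z))) by (apply Rmult_le_pos; nra).
      nra. }
    rewrite <- (sqrt_square (Cmod (psi z))) by exact Pp. apply sqrt_le_1; nra.
Qed.

(** * Growth bounds for functions of positive real part *)

Lemma Cmod_sub1_add1 (x : C) :
  Cmod (x + 1)%C * Cmod (x + 1)%C - Cmod (x - 1)%C * Cmod (x - 1)%C = 4 * Re x.
Proof. rewrite !Cmod_sqr. destruct x as [x1 x2]. unfold Re, Im; simpl. ring. Qed.

(** The Schwarz lemma for the Cayley transform (f - 1) / (f + 1), which is bounded by 1 because |f +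
    1|^2 - |f - 1|^2 = 4 Re f. *)
Lemma carath_bound (f : C -> C) (z : C) : inP f -> inD z ->
  Cmod (f z - 1)%C <= Cmod z * Cmod (f z + 1)%C.
Proof.
  intros [Ha [Hp H0]] Hz.
  assert (N : forall w, inD w -> (f w + 1)%C <> RtoC 0).
  { intros w Hw E. specialize (Hp w Hw). assert (K := f_equal Re E).
    unfold Re in *; simpl in K. unfold Cplus in K. simpl in K. lra. }
  assert (S : Cmod ((f z - 1) / (f z + 1))%C <= Cmod z).
  { apply (schwarz_lemma (fun w => (f w - 1) / (f w + 1))%C); auto.
    - intros w Hw. apply cdiff_div; [now apply N| |].
      + apply cdiff_minus; [apply ex_derive_cdiff, Ha, Hw|apply cdiff_const].
      + apply cdiff_plus; [apply ex_derive_cdiff, Ha, Hw|apply cdiff_const].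
    - intros w Hw. rewrite Cmod_div by now apply N.
      assert (P := proj1 (Cmod_gt_0 _) (N w Hw)).
      apply Rmult_le_reg_r with (Cmod (f w + 1)%C); [exact P|].
      unfold Rdiv. rewrite Rmult_assoc, Rinv_l, Rmult_1_r, Rmult_1_l by lra.
      apply Cmod_le_of_sqr. assert (E := Cmod_sub1_add1 (f w)). specialize (Hp w Hw). lra.
    - rewrite H0. unfold Cdiv. ring. }
  rewrite Cmod_div in S by now apply N. assert (P := proj1 (Cmod_gt_0 _) (N z Hz)).
  replace (Cmod (f z - 1)%C) with (Cmod (f z - 1)%C / Cmod (f z + 1)%C * Cmod (f z + 1)%C) by (field; lra).
  apply Rmult_le_compat_r; lra.
Qed.

(** The constant is the same for the whole class; this uniformity lets the iterates, themselves
    members of the class, be estimated without knowing them. From X <= |z| (X + 2) one gets X (1 -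
    r) <= 2 |z|. *)
Lemma carath_sub1 (f : C -> C) (z : C) (r : R) : inP f -> r < 1 -> Cmod z <= r ->
  Cmod (f z - 1)%C <= 2 / (1 - r) * Cmod z.
Proof.
  intros Hf Hr Hz. assert (Pz := Cmod_ge_0 z).
  assert (B := carath_bound f z Hf ltac:(unfold inD; lra)).
  assert (T := Cmod_triangle (f z - 1)%C (RtoC 2)). rewrite Cmod_R, Rabs_pos_eq in T by lra.
  replace (f z - 1 + 2)%C with (f z + 1)%C in T.
  2: { replace (RtoC 2) with (RtoC 1 + RtoC 1)%C by (rewrite <- RtoC_plus; f_equal; ring). ring. }
  set (X := Cmod (f z - 1)%C) in *. assert (PX : 0 <= X) by apply Cmod_ge_0.
  assert (B2 : X * (1 - r) <= 2 * Cmod z) by nra.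
  apply Rmult_le_reg_r with (1 - r); [lra|].
  replace (2 / (1 - r) * Cmod z * (1 - r)) with (2 * Cmod z) by (field; lra). exact B2.
Qed.

(** * Iteration *)

(** Weierstrass: Cauchy's formula passes to the limit, so near [z] the limit is the Cauchy transform
    of its own boundary values. *)
Lemma uniform_limit_cdiff (g : nat -> C -> C) (G : C -> C) (rho M : R) (z : C) :
  Cmod z < rho ->
  (forall n w, Cmod w <= rho -> cdiff (g n) w) ->
  (forall w, Cmod w <= rho -> Cmod (G w) <= M) ->
  (forall eps, 0 < eps -> exists n, forall w, Cmod w <= rho -> Cmod (g n w - G w)%C <= eps) ->
  cdiff G z.
Proof.
  intros Hz Hg HM Hlim. assert (HP := PI_RGT_0). assert (P := Cmod_ge_0 z).
  set (h := fun t => G (circ rho t)).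
  assert (Hc : forall t, Cmod (circ rho t) <= rho) by (intros t; rewrite Cmod_circ; lra).
  assert (Hgc : forall n t, rcont (fun t => g n (circ rho t)) t).
  { intros n t. apply rcont_comp; [apply Hg, Hc|apply rcont_circ]. }
  assert (Hh : forall t, rcont h t).
  { intros t eps He. assert (He4 : 0 < eps / 4) by lra. destruct (Hlim _ He4) as [n Hn].
    generalize (Hgc n t (eps / 4) He4). apply filter_imp. intros u Hu. unfold h.
    assert (K1 := Hn _ (Hc u)). assert (K2 := Hn _ (Hc t)).
    replace (G (circ rho u) - G (circ rho t))%C with
      ((g n (circ rho u) - g n (circ rho t)) + ((g n (circ rho t) - G (circ rho t))
        - (g n (circ rho u) - G (circ rho u))))%C by ring.
    eapply Rle_lt_trans; [apply Cmod_triangle|].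
    eapply Rle_lt_trans; [apply Rplus_le_compat_l, Cmod_tri_sub|]. lra. }
  assert (E : forall w, Cmod w < rho -> cauchy_int rho h w = (RtoC (2 * PI) * G w)%C).
  { intros w Hw. apply Cmod_eq_sub_0. apply le_epsilon. intros eps He. rewrite Rplus_0_l.
    assert (Pw := Cmod_ge_0 w).
    set (K := rho / (rho - Cmod w)). assert (PK : 0 < K) by (apply Rdiv_lt_0_compat; lra).
    (* Replacing [g n] by [G] costs 2 pi K e inside the integral and 2 pi e at the point [w]. *)
    set (e := eps / (2 * PI * (K + 1))).
    assert (Pe : 0 < e) by (apply Rdiv_lt_0_compat; nra).
    destruct (Hlim e Pe) as [n Hn].
    assert (Q := is_CI_plus _ _ _ _ _ _ (is_CI_cauchy_int rho h w Hw (fun t _ => Hh t))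
       (is_CI_scal (- RtoC 1) _ _ _ _ (cauchy_formula (g n) rho w Hw (Hg n)))).
    apply (is_CI_norm_le_const _ _ _ (K * e)) in Q; [|lra|].
    - replace (cauchy_int rho h w - RtoC (2 * PI) * G w)%C with
        ((cauchy_int rho h w + - RtoC 1 * (RtoC (2 * PI) * g n w)) + RtoC (2 * PI) * (g n w - G w))%C by ring.
      eapply Rle_trans; [apply Cmod_triangle|].
      rewrite (Cmod_mult (RtoC (2 * PI))), Cmod_R, Rabs_pos_eq by lra.
      assert (K1 := Hn w ltac:(lra)).
      apply Rle_trans with (K * e * (2 * PI - 0) + 2 * PI * e).
      + apply Rplus_le_compat; [exact Q|]. apply Rmult_le_compat_l; lra.
      + right. unfold e. field. split; lra.
    - intros t _. unfold h.
      replace (ckern rho w t * G (circ rho t) + - RtoC 1 * (ckern rho w t * g n (circ rho t)))%C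
        with (ckern rho w t * (G (circ rho t) - g n (circ rho t)))%C by ring.
      rewrite Cmod_mult.
      apply Rmult_le_compat; [apply Cmod_ge_0|apply Cmod_ge_0|now apply Cmod_ckern_le|].
      rewrite Cmod_sub_sym. apply Hn, Hc. }
  apply cdiff_ext with (fun w => / RtoC (2 * PI) * cauchy_int rho h w)%C.
  - generalize (locally_Cmod_lt z rho Hz). apply filter_imp. intros w Hw. rewrite E by exact Hw.
    assert (N2 : RtoC (2 * PI) <> RtoC 0) by (apply Cmod_gt_neq0; rewrite Cmod_R, Rabs_pos_eq; lra).
    cfield. exact N2.
  - apply cdiff_scal. apply cdiff_cauchy_int with M; [exact Hz|intros; apply Hh|].
    intros t _. apply HM, Hc.
Qed.

Lemma pow_small (c y : R) : 0 <= c < 1 -> 0 < y -> exists N, forall n, (N <= n)%nat -> c ^ n < y.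
Proof.
  intros Hc Hy. destruct (pow_lt_1_zero c ltac:(rewrite Rabs_pos_eq; lra) y Hy) as [N HN].
  exists N. intros n Hn. specialize (HN n Hn). rewrite Rabs_pos_eq in HN; [exact HN|].
  apply pow_le. lra.
Qed.

Lemma C_limit_of_bound (u : nat -> C) (b : nat -> R) :
  (forall n k, Cmod (u (n + k)%nat - u n)%C <= b n) ->
  (forall eps, 0 < eps -> exists n, b n < eps) ->
  exists l, forall n, Cmod (u n - l)%C <= b n.
Proof.
  intros Hu Hb.
  assert (Cau : forall eps : posreal, exists N, forall n m, (N <= n)%nat -> (N <= m)%nat ->
            Cmod (u n - u m)%C < eps).
  { intros eps. destruct (Hb (eps / 2)) as [N HN]. { assert (P := cond_pos eps). lra. }
    exists N. intros n m Hn Hm.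
    assert (K1 := Hu N (n - N)%nat). assert (K2 := Hu N (m - N)%nat).
    replace (N + (n - N))%nat with n in K1 by lia. replace (N + (m - N))%nat with m in K2 by lia.
    replace (u n - u m)%C with ((u n - u N) - (u m - u N))%C by ring.
    eapply Rle_lt_trans; [apply Cmod_tri_sub|]. lra. }
  assert (LR : ex_finite_lim_seq (fun n => Re (u n))).
  { apply ex_lim_seq_cauchy_corr. intros eps. destruct (Cau eps) as [N HN]. exists N. intros n m Hn Hm.
    eapply Rle_lt_trans; [|exact (HN n m Hn Hm)]. exact (abs_Re_le (u n - u m)%C). }
  assert (LI : ex_finite_lim_seq (fun n => Im (u n))).
  { apply ex_lim_seq_cauchy_corr. intros eps. destruct (Cau eps) as [N HN]. exists N. intros n m Hn Hm.
    eapply Rle_lt_trans; [|exact (HN n m Hn Hm)]. exact (abs_Im_le (u n - u m)%C). }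
  destruct LR as [x Hx]. destruct LI as [y Hy]. exists (x, y). intros n.
  apply le_epsilon. intros eps He.
  assert (He2 : 0 < eps / 2) by lra.
  destruct (proj2 (is_lim_seq_spec _ _) Hx (mkposreal _ He2)) as [N1 H1].
  destruct (proj2 (is_lim_seq_spec _ _) Hy (mkposreal _ He2)) as [N2 H2].
  set (k := Nat.max N1 N2). specialize (H1 (n + k)%nat ltac:(unfold k; lia)).
  specialize (H2 (n + k)%nat ltac:(unfold k; lia)). simpl in H1, H2.
  assert (K := Cmod_le_Re_Im (u (n + k)%nat - (x, y))%C).
  change (Re (u (n + k)%nat - (x, y))%C) with (Re (u (n + k)%nat) - x) in K.
  change (Im (u (n + k)%nat - (x, y))%C) with (Im (u (n + k)%nat) - y) in K.
  specialize (Hu n k). rewrite Cmod_sub_sym in Hu.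
  replace (u n - (x, y))%C with ((u n - u (n + k)%nat) + (u (n + k)%nat - (x, y)))%C by ring.
  eapply Rle_trans; [apply Cmod_triangle|]. lra.
Qed.

Section Iteration.
Variables (F phi : C -> C).
Hypothesis Hphi : schwarz_type phi.
Hypothesis Hrot : ~ is_rotation phi.
Hypothesis HT : forall f, inP f -> inP (T_op F phi f).

Let one : C -> C := fun _ => RtoC 1.

Lemma inP_one : inP (fun _ => RtoC 1).
Proof.
  split; [|split].
  - intros z _. apply cdiff_ex_derive, cdiff_const.
  - intros z _. simpl. lra.
  - reflexivity.
Qed.

Lemma inP_T_iter (n : nat) (f : C -> C) : inP f -> inP (T_iter F phi n f).
Proof. intros Hf. induction n as [|n IH]; [exact Hf|]. apply HT, IH. Qed.

Lemma T_iter_split (n : nat) (f : C -> C) (z : C) :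
  T_iter F phi n f z = (T_iter F phi n one z * f (Nat.iter n phi z))%C.
Proof.
  revert z. induction n as [|n IH]; intros z.
  - unfold T_iter, one; simpl. ring.
  - rewrite Nat.iter_succ_r. unfold T_iter in *; simpl. unfold T_op at 1 3. rewrite IH. ring.
Qed.

Lemma T_iter_S_one (n : nat) :
  T_iter F phi (S n) one = T_iter F phi n (T_op F phi one).
Proof. unfold T_iter. apply Nat.iter_succ_r. Qed.

Lemma iter_phi_bound (r c : R) (n : nat) (z : C) : 0 <= c < 1 ->
  (forall z, Cmod z <= r -> Cmod (phi z) <= c * Cmod z) -> Cmod z <= r ->
  Cmod (Nat.iter n phi z) <= c ^ n * Cmod z /\ Cmod (Nat.iter n phi z) <= r.
Proof.
  intros Hc H Hz. induction n as [|n [IH1 IH2]]; simpl; [lra|].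
  specialize (H _ IH2). assert (P := Cmod_ge_0 (Nat.iter n phi z)). assert (Pz := Cmod_ge_0 z).
  split; [|nra].
  eapply Rle_trans; [exact H|]. rewrite Rmult_assoc. apply Rmult_le_compat_l; lra.
Qed.

Lemma inP_bound (f : C -> C) (r : R) (z : C) : inP f -> r < 1 -> Cmod z <= r ->
  Cmod (f z) <= 1 + 2 / (1 - r).
Proof.
  intros Hf Hr Hz. assert (B := carath_sub1 f z r Hf Hr Hz).
  assert (K := Cmod_le_via (f z) (RtoC 1)). rewrite Cmod_1 in K.
  assert (0 < 2 / (1 - r)) by (apply Rdiv_lt_0_compat; lra). assert (P := Cmod_ge_0 z). nra.
Qed.

Lemma T_iter_close (r : R) : 0 <= r < 1 ->
  exists c K, 0 <= c < 1 /\ 0 <= K /\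
    forall f n z, inP f -> Cmod z <= r ->
      Cmod (T_iter F phi n f z - T_iter F phi n one z)%C <= K * c ^ n.
Proof.
  intros Hr. destruct (not_rotation_contracts phi r Hphi Hrot Hr) as [c [Hc H]].
  assert (Pr : 0 < 2 / (1 - r)) by (apply Rdiv_lt_0_compat; lra).
  (* The first factor bounds the iterate of 1, a member of the class; the second is the constant of
     [carath_sub1] for f - 1 at the iterated point, of modulus at most c^n. Neither depends on
     [f]. *)
  exists c, ((1 + 2 / (1 - r)) * (2 / (1 - r))). split; [exact Hc|]. split; [nra|].
  intros f n z Hf Hz. rewrite T_iter_split.
  replace (T_iter F phi n one z * f (Nat.iter n phi z) - T_iter F phi n one z)%C
    with (T_iter F phi n one z * (f (Nat.iter n phi z) - 1))%C by ring.
  rewrite Cmod_mult, Rmult_assoc.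
  destruct (iter_phi_bound r c n z Hc H Hz) as [B1 B2].
  apply Rmult_le_compat; [apply Cmod_ge_0|apply Cmod_ge_0| |].
  - apply inP_bound; [apply inP_T_iter, inP_one|lra|exact Hz].
  - eapply Rle_trans; [apply (carath_sub1 f _ r); [exact Hf|lra|exact B2]|].
    apply Rmult_le_compat_l; [lra|]. assert (Pc : 0 <= c ^ n) by (apply pow_le; lra). nra.
Qed.

(** Consecutive iterates of 1 differ as in [T_iter_close] with f = T 1, which is again in the class;
    the differences then sum geometrically. *)
Lemma T_iter_one_cauchy (r : R) : 0 <= r < 1 ->
  exists c K, 0 <= c < 1 /\ 0 <= K /\
    forall n k z, Cmod z <= r ->
      Cmod (T_iter F phi (n + k) one z - T_iter F phi n one z)%C <= K * c ^ n.
Proof.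
  intros Hr. destruct (T_iter_close r Hr) as [c [K [Hc [HK H]]]].
  exists c, (K / (1 - c)). split; [exact Hc|]. split.
  { apply Rmult_le_pos; [exact HK|]. apply Rlt_le, Rinv_0_lt_compat; lra. }
  intros n k z Hz.
  (* The exact partial geometric sum, which is what induction on [k] can carry. *)
  apply Rle_trans with (K / (1 - c) * (c ^ n - c ^ (n + k))).
  - induction k as [|k IH].
    + rewrite Nat.add_0_r, Cmod_sub_0. lra.
    + rewrite Nat.add_succ_r.
      specialize (H (T_op F phi one) (n + k)%nat z (HT _ inP_one) Hz). rewrite <- T_iter_S_one in H.
      replace (T_iter F phi (S (n + k)) one z - T_iter F phi n one z)%C with
        ((T_iter F phi (S (n + k)) one z - T_iter F phi (n + k) one z)
         + (T_iter F phi (n + k) one z - T_iter F phi n one z))%C by ring.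
      eapply Rle_trans; [apply Cmod_triangle|].
      replace (K / (1 - c) * (c ^ n - c ^ S (n + k))) with
        (K * c ^ (n + k) + K / (1 - c) * (c ^ n - c ^ (n + k))) by (simpl; field; lra).
      lra.
  - assert (0 <= c ^ (n + k)) by (apply pow_le; lra).
    assert (0 <= K / (1 - c)) by (apply Rmult_le_pos; [exact HK|apply Rlt_le, Rinv_0_lt_compat; lra]).
    nra.
Qed.

Lemma geometric_small (c K eps : R) : 0 <= c < 1 -> 0 <= K -> 0 < eps ->
  exists N, forall n, (N <= n)%nat -> K * c ^ n < eps.
Proof.
  intros Hc HK He. destruct (pow_small c (eps / (K + 1)) Hc) as [N HN].
  { apply Rdiv_lt_0_compat; lra. }
  exists N. intros n Hn. specialize (HN n Hn). assert (P : 0 <= c ^ n) by (apply pow_le; lra).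
  apply Rle_lt_trans with ((K + 1) * c ^ n); [nra|].
  replace eps with ((K + 1) * (eps / (K + 1))) by (field; lra). apply Rmult_lt_compat_l; lra.
Qed.

(** [G] must not depend on [r], while the rates do. So [G] is first chosen pointwise from a
    statement without rates, with an arbitrary value off the disk, and the rate on each |z| <= r is
    recovered afterwards. *)
Lemma T_iter_limit : exists G, forall r, 0 <= r < 1 ->
  exists c K, 0 <= c < 1 /\ 0 <= K /\
    forall f n z, inP f -> Cmod z <= r -> Cmod (T_iter F phi n f z - G z)%C <= K * c ^ n.
Proof.
  assert (Ex : forall z, exists l, inD z -> forall eps, 0 < eps ->
            exists N, forall n, (N <= n)%nat -> Cmod (T_iter F phi n one z - l)%C < eps).
  { intros z. destruct (classic (inD z)) as [Hz|N]; [|exists (RtoC 0); tauto].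
    assert (P := Cmod_ge_0 z).
    destruct (T_iter_one_cauchy (Cmod z)) as [c [K [Hc [HK H]]]]; [unfold inD in Hz; lra|].
    destruct (C_limit_of_bound (fun n => T_iter F phi n one z) (fun n => K * c ^ n)) as [l Hl].
    - intros n k. apply H. lra.
    - intros eps He. destruct (geometric_small c K eps Hc HK He) as [N HN]. exists N. apply HN, le_n.
    - exists l. intros _ eps He. destruct (geometric_small c K eps Hc HK He) as [N HN].
      exists N. intros n Hn. eapply Rle_lt_trans; [apply Hl|now apply HN]. }
  destruct (choice _ Ex) as [G HG]. exists G. intros r Hr.
  destruct (T_iter_close r Hr) as [c1 [K1 [Hc1 [HK1 H1]]]].
  destruct (T_iter_one_cauchy r Hr) as [c2 [K2 [Hc2 [HK2 H2]]]].
  assert (B : forall n z, Cmod z <= r -> Cmod (T_iter F phi n one z - G z)%C <= K2 * c2 ^ n).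
  { intros n z Hz. apply le_epsilon. intros eps He.
    destruct (HG z ltac:(unfold inD; lra) eps He) as [N HN].
    specialize (HN (n + N)%nat ltac:(lia)). specialize (H2 n N z Hz). rewrite Cmod_sub_sym in H2.
    replace (T_iter F phi n one z - G z)%C with
      ((T_iter F phi n one z - T_iter F phi (n + N) one z) + (T_iter F phi (n + N) one z - G z))%C by ring.
    eapply Rle_trans; [apply Cmod_triangle|]. lra. }
  exists (Rmax c1 c2), (K1 + K2).
  assert (M1 := Rmax_l c1 c2). assert (M2 := Rmax_r c1 c2).
  split; [|split; [lra|]].
  { split; [lra|]. apply Rmax_lub_lt; lra. }
  intros f n z Hf Hz. specialize (H1 f n z Hf Hz). specialize (B n z Hz).
  replace (T_iter F phi n f z - G z)%C with
    ((T_iter F phi n f z - T_iter F phi n one z) + (T_iter F phi n one z - G z))%C by ring.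
  eapply Rle_trans; [apply Cmod_triangle|].
  assert (Q1 : c1 ^ n <= Rmax c1 c2 ^ n) by (apply pow_incr; lra).
  assert (Q2 : c2 ^ n <= Rmax c1 c2 ^ n) by (apply pow_incr; lra).
  nra.
Qed.

Lemma eq_of_eventually_close (x y : C) :
  (forall eps, 0 < eps -> Cmod (x - y)%C <= eps) -> x = y.
Proof.
  intros H. apply Cmod_eq_sub_0. apply le_epsilon. intros eps He. rewrite Rplus_0_l. now apply H.
Qed.

Lemma T_iter_attracting_fixed_point : exists G, inP G /\ is_fixed F phi G /\
  forall r, 0 <= r < 1 -> forall eps, 0 < eps ->
    forall f, inP f -> exists N, forall n, (N <= n)%nat ->
      forall z, Cmod z <= r -> Cmod (T_iter F phi n f z - G z)%C < eps.
Proof.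
  destruct T_iter_limit as [G HG].
  assert (Conv : forall r, 0 <= r < 1 -> forall eps, 0 < eps ->
    forall f, inP f -> exists N, forall n, (N <= n)%nat ->
      forall z, Cmod z <= r -> Cmod (T_iter F phi n f z - G z)%C < eps).
  { intros r Hr eps He f Hf. destruct (HG r Hr) as [c [K [Hc [HK H]]]].
    destruct (geometric_small c K eps Hc HK He) as [N HN]. exists N. intros n Hn z Hz.
    eapply Rle_lt_trans; [apply H; auto|now apply HN]. }
  exists G. split; [|split; [|exact Conv]].
  - split; [|split].
    + intros z Hz. apply cdiff_ex_derive. unfold inD in Hz. assert (P := Cmod_ge_0 z).
      set (r := (1 + Cmod z) / 2). assert (Hr : Cmod z < r < 1) by (unfold r; lra).
      apply (uniform_limit_cdiff (fun n => T_iter F phi n one) G r (1 + 2 / (1 - r) + 1)); [lra| | |].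
      * intros n w Hw. apply ex_derive_cdiff. apply (inP_T_iter n one inP_one). unfold inD. lra.
      * intros w Hw. destruct (Conv r ltac:(lra) 1 ltac:(lra) one inP_one) as [N HN].
        specialize (HN N (le_n N) w Hw). rewrite Cmod_sub_sym in HN.
        assert (K := Cmod_le_via (G w) (T_iter F phi N one w)).
        assert (B := inP_bound _ r w (inP_T_iter N one inP_one) ltac:(lra) Hw). lra.
      * intros eps He. destruct (Conv r ltac:(lra) eps He one inP_one) as [N HN].
        exists N. intros w Hw. apply Rlt_le, HN; auto.
    + intros z Hz. assert (P := Cmod_ge_0 z). unfold inD in Hz.
      (* The bound [|f - 1| <= |z| |f + 1|], unlike [0 < Re f], survives in the limit. *)
      assert (B : Cmod (G z - 1)%C <= Cmod z * Cmod (G z + 1)%C).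
      { apply le_epsilon. intros eps He.
        destruct (Conv (Cmod z) ltac:(lra) (eps / 2) ltac:(lra) one inP_one) as [N HN].
        specialize (HN N (le_n N) z ltac:(lra)).
        assert (K := carath_bound _ z (inP_T_iter N one inP_one) Hz).
        set (x := T_iter F phi N one z) in *.
        assert (K1 := Cmod_le_via (G z - 1)%C (x - 1)%C).
        replace (G z - 1 - (x - 1))%C with (G z - x)%C in K1 by ring.
        assert (K2 := Cmod_le_via (x + 1)%C (G z + 1)%C).
        replace (x + 1 - (G z + 1))%C with (x - G z)%C in K2 by ring.
        rewrite (Cmod_sub_sym (G z) x) in K1. nra. }
      assert (E := Cmod_sub1_add1 (G z)).
      assert (P1 := Cmod_ge_0 (G z - 1)%C). assert (P2 := Cmod_ge_0 (G z + 1)%C).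
      (* As |z| < 1, the bound gives |G - 1| < |G + 1|, that is Re G > 0, unless |G + 1| = 0; then
         |G - 1| = 0 too, which is absurd. *)
      destruct (Req_dec (Cmod (G z + 1)%C) 0) as [E0|N0].
      * exfalso. rewrite E0, Rmult_0_r in B.
        assert (T := Cmod_tri_sub (G z + 1)%C (G z - 1)%C).
        replace (G z + 1 - (G z - 1))%C with (RtoC 1 + RtoC 1)%C in T by ring.
        rewrite <- RtoC_plus, Cmod_R, Rabs_pos_eq in T by lra. lra.
      * assert (Cmod (G z - 1)%C < Cmod (G z + 1)%C) by nra. nra.
    + apply eq_of_eventually_close. intros eps He. rewrite Cmod_sub_sym.
      destruct (Conv 0 ltac:(lra) eps He one inP_one) as [N HN].
      specialize (HN N (le_n N) (RtoC 0) ltac:(rewrite Cmod_0; lra)).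
      rewrite (proj2 (proj2 (inP_T_iter N one inP_one))) in HN. lra.
  - intros z Hz. assert (P := Cmod_ge_0 z). unfold inD in Hz.
    assert (Hpz : inD (phi z)) by now apply Hphi.
    assert (Pp := Cmod_ge_0 (phi z)). unfold inD in Hpz.
    assert (PF := Cmod_ge_0 (F z)).
    apply eq_of_eventually_close. intros eps He. unfold T_op.
    assert (He1 : 0 < eps / 2 / (Cmod (F z) + 1)) by (apply Rdiv_lt_0_compat; lra).
    destruct (Conv (Cmod (phi z)) ltac:(lra) _ He1 one inP_one) as [N1 H1].
    destruct (Conv (Cmod z) ltac:(lra) (eps / 2) ltac:(lra) one inP_one) as [N2 H2].
    set (n := Nat.max N1 N2).
    (* The iterate [n] at [phi z] and the iterate [S n] at [z] are linked by one application of [T],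
       so both limits enter the same equation. *)
    specialize (H1 n ltac:(unfold n; lia) (phi z) ltac:(lra)).
    specialize (H2 (S n) ltac:(unfold n; lia) z ltac:(lra)).
    change (T_iter F phi (S n) one z) with (F z * T_iter F phi n one (phi z))%C in H2.
    set (x := T_iter F phi n one (phi z)) in *.
    replace (F z * G (phi z) - G z)%C with ((F z * x - G z) - F z * (x - G (phi z)))%C by ring.
    eapply Rle_trans; [apply Cmod_tri_sub|]. rewrite (Cmod_mult (F z) (x - _)%C).
    assert (P1 := Cmod_ge_0 (x - G (phi z))%C).
    assert (Cmod (F z) * Cmod (x - G (phi z))%C <= eps / 2).
    { apply Rle_trans with ((Cmod (F z) + 1) * (eps / 2 / (Cmod (F z) + 1))).
      - apply Rmult_le_compat; lra.
      - right. field. lra. }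
    lra.
Qed.

Lemma T_iter_fixed (H : C -> C) (n : nat) (z : C) :
  is_fixed F phi H -> inD z -> T_iter F phi n H z = H z.
Proof.
  intros HH. revert z. induction n as [|n IH]; intros z Hz; [reflexivity|].
  change (T_iter F phi (S n) H z) with (F z * T_iter F phi n H (phi z))%C.
  rewrite IH by now apply Hphi. now apply HH.
Qed.

End Iteration.

Lemma open_Cmod_lt (r : R) : @open C_UniformSpace (fun z => Cmod z < r).
Proof. intros z Hz. now apply locally_Cmod_lt. Qed.

Lemma compact_in_smaller_disk (K : C -> Prop) : compact_C K -> (forall z, K z -> inD z) ->
  exists r, 0 <= r < 1 /\ forall z, K z -> Cmod z <= r.
Proof.
  intros HK Hin.
  destruct (HK {r : R | 0 <= r < 1} (fun r z => Cmod z < proj1_sig r)) as [l Hl].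
  - intros r. apply open_Cmod_lt.
  - intros z Hz. specialize (Hin z Hz). unfold inD in Hin. assert (P := Cmod_ge_0 z).
    assert (Hr : 0 <= (1 + Cmod z) / 2 < 1) by lra. exists (exist (fun r => 0 <= r < 1) _ Hr). simpl. lra.
  - assert (B : exists r, 0 <= r < 1 /\ forall i, In i l -> proj1_sig i <= r).
    { clear. induction l as [|i l [r [Hr H]]].
      - exists 0. split; [lra|]. intros i [].
      - exists (Rmax (proj1_sig i) r). destruct i as [s Hs]; simpl.
        assert (M1 := Rmax_l s r). assert (M2 := Rmax_r s r). split.
        + split; [lra|]. apply Rmax_lub_lt; lra.
        + intros j [<-|Hj]; simpl; [lra|]. specialize (H j Hj). lra. }
    destruct B as [r [Hr H]]. exists r. split; [exact Hr|].
    intros z Hz. destruct (Hl z Hz) as [i [Hi Hiz]]. specialize (H i Hi). lra.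
Qed.

(** * Bounded convergence off a null set *)

Lemma continuous_Rmax_fun (f g : R -> R) (x : R) :
  continuous f x -> continuous g x -> continuous (fun t => Rmax (f t) (g t)) x.
Proof.
  intros Hf Hg. apply filterlim_locally. intros eps.
  generalize (filter_and _ _ (proj1 (filterlim_locally _ _) Hf eps) (proj1 (filterlim_locally _ _) Hg eps)).
  apply filter_imp. intros u [H1 H2].
  change (Rabs (f u - f x) < eps) in H1. change (Rabs (g u - g x) < eps) in H2.
  change (Rabs (Rmax (f u) (g u) - Rmax (f x) (g x)) < eps).
  apply Rabs_def2 in H1. apply Rabs_def2 in H2. unfold Rmax.
  apply Rabs_def1; destruct (Rle_dec (f u) (g u)), (Rle_dec (f x) (g x)); lra.
Qed.

Lemma continuous_Rmin_fun (f g : R -> R) (x : R) :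
  continuous f x -> continuous g x -> continuous (fun t => Rmin (f t) (g t)) x.
Proof.
  intros Hf Hg. apply filterlim_locally. intros eps.
  generalize (filter_and _ _ (proj1 (filterlim_locally _ _) Hf eps) (proj1 (filterlim_locally _ _) Hg eps)).
  apply filter_imp. intros u [H1 H2].
  change (Rabs (f u - f x) < eps) in H1. change (Rabs (g u - g x) < eps) in H2.
  change (Rabs (Rmin (f u) (g u) - Rmin (f x) (g x)) < eps).
  apply Rabs_def2 in H1. apply Rabs_def2 in H2. unfold Rmin.
  apply Rabs_def1; destruct (Rle_dec (f u) (g u)), (Rle_dec (f x) (g x)); lra.
Qed.

Lemma is_RInt_cont (f : R -> R) (a b : R) :
  (forall t, continuous f t) -> is_RInt f a b (RInt f a b).
Proof.
  intros H. apply (RInt_correct (V := R_CompleteNormedModule)).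
  apply (ex_RInt_continuous (V := R_CompleteNormedModule)). intros t _. apply H.
Qed.

Definition ind (p q x : R) : R :=
  if Rlt_dec p x then if Rlt_dec x q then 1 else 0 else 0.

Lemma ind_ge_0 (p q x : R) : 0 <= ind p q x.
Proof. unfold ind. destruct (Rlt_dec p x); [destruct (Rlt_dec x q)|]; lra. Qed.

Lemma is_RInt_ind (p q a b : R) : a <= b -> p <= q ->
  exists I, is_RInt (ind p q) a b I /\ I <= q - p.
Proof.
  intros Hab Hpq.
  (* Endpoints clamped to [a, b], since the interval may stick out of it or miss it altogether. *)
  set (p' := Rmax a (Rmin p b)). set (q' := Rmax a (Rmin q b)).
  assert (Hp : a <= p' <= b) by (unfold p', Rmax, Rmin; destruct (Rle_dec p b); destruct (Rle_dec a _); lra).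
  assert (Hq : p' <= q' <= b).
  { unfold p', q', Rmax, Rmin; destruct (Rle_dec p b), (Rle_dec q b); repeat destruct (Rle_dec a _); lra. }
  assert (Hd : q' - p' <= q - p).
  { unfold p', q', Rmax, Rmin; destruct (Rle_dec p b), (Rle_dec q b); repeat destruct (Rle_dec a _); lra. }
  exists (plus (plus (scal (p' - a) 0) (scal (q' - p') 1)) (scal (b - q') 0)). split.
  - apply (is_RInt_Chasles (V := R_NormedModule)) with q'; [apply (is_RInt_Chasles (V := R_NormedModule)) with p'|].
    + apply is_RInt_ext with (fun _ => 0); [|apply (is_RInt_const (V := R_NormedModule))].
      intros x. rewrite Rmin_left, Rmax_right by lra. intros Hx. unfold ind.
      destruct (Rlt_dec p x) as [L|]; [|reflexivity]. exfalso. revert Hx L.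
      unfold p', Rmax, Rmin; destruct (Rle_dec p b); destruct (Rle_dec a _); lra.
    + apply is_RInt_ext with (fun _ => 1); [|apply (is_RInt_const (V := R_NormedModule))].
      intros x. rewrite Rmin_left, Rmax_right by lra. intros Hx. unfold ind.
      destruct (Rlt_dec p x) as [L|L]; [destruct (Rlt_dec x q) as [L2|L2]; [reflexivity|]|]; exfalso; revert Hx L; try revert L2;
      unfold p', q', Rmax, Rmin; destruct (Rle_dec p b), (Rle_dec q b); repeat destruct (Rle_dec a _); lra.
    + apply is_RInt_ext with (fun _ => 0); [|apply (is_RInt_const (V := R_NormedModule))].
      intros x. rewrite Rmin_left, Rmax_right by lra. intros Hx. unfold ind.
      destruct (Rlt_dec p x) as [L|]; [|reflexivity]. destruct (Rlt_dec x q) as [L2|]; [|reflexivity].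
      exfalso. revert Hx L L2.
      unfold q', Rmax, Rmin; destruct (Rle_dec q b); destruct (Rle_dec a _); lra.
  - unfold plus, scal; simpl. unfold mult; simpl. lra.
Qed.

Lemma is_RInt_sum_ind (p q : nat -> R) (a b : R) (N : nat) : a <= b -> (forall n, p n <= q n) ->
  exists I, is_RInt (fun x => sum_f_R0 (fun n => ind (p n) (q n) x) N) a b I /\
    I <= sum_f_R0 (fun n => q n - p n) N.
Proof.
  intros Hab Hpq. induction N as [|N [I [HI LI]]]; simpl.
  - now apply is_RInt_ind.
  - destruct (is_RInt_ind (p (S N)) (q (S N)) a b Hab (Hpq _)) as [J [HJ LJ]].
    exists (I + J). split; [exact (is_RInt_plus _ _ _ _ _ _ HI HJ)|lra].
Qed.

Lemma sum_ind_ge_1 (p q : nat -> R) (x : R) (N i : nat) :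
  (i <= N)%nat -> p i < x < q i -> 1 <= sum_f_R0 (fun n => ind (p n) (q n) x) N.
Proof.
  intros Hi Hx. induction N as [|N IH].
  - replace i with 0%nat in Hx by lia. simpl. unfold ind.
    destruct (Rlt_dec (p 0%nat) x); [destruct (Rlt_dec x (q 0%nat))|]; lra.
  - simpl. destruct (Nat.eq_dec i (S N)) as [->|N'].
    + assert (0 <= sum_f_R0 (fun n => ind (p n) (q n) x) N) by (apply cond_pos_sum; intros; apply ind_ge_0).
      assert (E : ind (p (S N)) (q (S N)) x = 1).
      { unfold ind. destruct (Rlt_dec (p (S N)) x); [destruct (Rlt_dec x (q (S N)))|]; lra. }
      rewrite E. lra.
    + assert (K := IH ltac:(lia)). assert (P := ind_ge_0 (p (S N)) (q (S N)) x). lra.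
Qed.

Lemma inv_INR_small (d : R) : 0 < d -> exists N, forall n, (N <= n)%nat -> / (INR n + 1) < d.
Proof.
  intros Hd. destruct (nfloor_ex (/ d)) as [N [_ HN]]; [apply Rlt_le, Rinv_0_lt_compat, Hd|].
  exists N. intros n Hn. apply le_INR in Hn.
  rewrite <- (Rinv_inv d). apply Rinv_lt_contravar; [|lra].
  apply Rmult_lt_0_compat; [now apply Rinv_0_lt_compat|]. assert (P := pos_INR n). lra.
Qed.

(* Dini's argument: a finite subfamily of the intervals covering [E] and a single index [n] suffice. *)
Lemma dini_off_null_set (k : nat -> R -> R) (E : R -> Prop) (a b eta : R) :
  a <= b -> (forall n t, continuous (k n) t) -> (forall n t, k n t <= 1) ->
  (forall n m t, (n <= m)%nat -> k m t <= k n t) ->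
  null_set E -> (forall t, ~ E t -> forall e, 0 < e -> exists n, k n t < e) ->
  0 < eta -> exists n, RInt (k n) a b <= eta * (b - a) + eta.
Proof.
  intros Hab Hc H1 Hdec HE Hlim Heta.
  destruct (HE eta Heta) as [p [q [Hcov [Hpq Hsum]]]].
  (* One number [N] serves as inverse radius of the neighbourhood, as index of the function and as
     bound on the interval indices. All three conditions survive enlarging [N], so a bound on [N]
     suffices for compactness. *)
  assert (Ex : forall t, exists N : nat, forall s, Rabs (s - t) < / (INR N + 1) ->
            k N s < eta \/ exists i, (i <= N)%nat /\ p i < s < q i).
  { intros t. destruct (classic (E t)) as [Et|Nt].
    - destruct (Hcov t Et) as [i Hi].
      destruct (inv_INR_small (Rmin (t - p i) (q i - t))) as [N HN]; [apply Rmin_pos; lra|].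
      exists (Nat.max i N). intros s Hs. right. exists i. split; [lia|].
      specialize (HN (Nat.max i N) ltac:(lia)).
      assert (M1 := Rmin_l (t - p i) (q i - t)). assert (M2 := Rmin_r (t - p i) (q i - t)).
      apply Rabs_def2 in Hs. lra.
    - destruct (Hlim t Nt eta Heta) as [n Hn].
      assert (He : 0 < eta - k n t) by lra.
      destruct (proj1 (filterlim_locally _ _) (Hc n t) (mkposreal _ He)) as [d Hd].
      destruct (inv_INR_small d (cond_pos d)) as [N HN].
      exists (Nat.max n N). intros s Hs. left. specialize (HN (Nat.max n N) ltac:(lia)).
      apply Rle_lt_trans with (k n s); [apply Hdec; lia|].
      assert (B : ball t d s) by (change (Rabs (s - t) < d); lra).
      specialize (Hd s B). change (Rabs (k n s - k n t) < eta - k n t) in Hd.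
      apply Rabs_def2 in Hd. lra. }
  destruct (choice _ Ex) as [Nf HN].
  assert (Pd : forall t, 0 < / (INR (Nf t) + 1)).
  { intros t. apply Rinv_0_lt_compat. assert (P := pos_INR (Nf t)). lra. }
  (* Every point of [a, b] lies in a neighbourhood of radius at least [d], whose [N] is therefore at
     most 1/d. *)
  destruct (compactness_value_1d a b (fun t => mkposreal _ (Pd t))) as [d Hd].
  destruct (nfloor_ex (/ d)) as [M [_ HM]]; [apply Rlt_le, Rinv_0_lt_compat, cond_pos|].
  assert (Cov : forall x, a <= x <= b -> k M x < eta \/ exists i, (i <= M)%nat /\ p i < x < q i).
  { intros x Hx. assert (Q := Hd x Hx). apply NNPP in Q. destruct Q as [t [_ [Q1 Q2]]].
    simpl in Q1, Q2.
    assert (L : (Nf t <= M)%nat).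
    { apply Nat.lt_succ_r, INR_lt. rewrite S_INR.
      assert (PN := pos_INR (Nf t)).
      assert (INR (Nf t) + 1 <= / d).
      { rewrite <- (Rinv_inv (INR (Nf t) + 1)). apply Rinv_le_contravar; [apply cond_pos|exact Q2]. }
      lra. }
    destruct (HN t x Q1) as [K|[i [Hi K]]].
    - left. apply Rle_lt_trans with (k (Nf t) x); [now apply Hdec|exact K].
    - right. exists i. split; [lia|exact K]. }
  exists M.
  destruct (is_RInt_sum_ind p q a b M Hab Hpq) as [I [HI LI]]. specialize (Hsum M).
  (* The integrable majorant of [k M]: eta where it is small, plus the indicators of the covering
     intervals, on which only k <= 1 is used. *)
  assert (Q := is_RInt_plus _ _ _ _ _ _ (is_RInt_const (V := R_NormedModule) a b eta) HI).
  assert (L := is_RInt_le _ _ _ _ _ _ Hab (is_RInt_cont (k M) a b (Hc M)) Q).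
  unfold plus, scal in L; simpl in L. unfold mult in L; simpl in L.
  eapply Rle_trans; [apply L|nra].
  intros x Hx. destruct (Cov x ltac:(lra)) as [K|[i [Hi K]]].
  - assert (0 <= sum_f_R0 (fun n => ind (p n) (q n) x) M) by (apply cond_pos_sum; intros; apply ind_ge_0). lra.
  - assert (S := sum_ind_ge_1 p q x M i Hi K). specialize (H1 M x). lra.
Qed.

(** * Arzela's theorem for uniformly bounded continuous functions *)

Section Arzela.
Variables (g : nat -> R -> R) (a b : R).
Hypothesis Hab : a <= b.
Hypothesis g_cont : forall n t, continuous (g n) t.
Hypothesis g_bound : forall n t, 0 <= g n t <= 1.

(** Finite maxima stand in for the supremum of the tail, which may fail to be Riemann integrable. *)
Fixpoint tail_max (n k : nat) (t : R) : R :=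
  match k with
  | O => g n t
  | S k => Rmax (tail_max n k t) (g (n + S k) t)
  end.

Lemma tail_max_cont (n k : nat) (t : R) : continuous (tail_max n k) t.
Proof.
  induction k as [|k IH]; simpl; [apply g_cont|].
  apply (continuous_Rmax_fun (tail_max n k) (g (n + S k))); [exact IH|apply g_cont].
Qed.

Lemma tail_max_bound (n k : nat) (t : R) : 0 <= tail_max n k t <= 1.
Proof.
  induction k as [|k IH]; simpl; [apply g_bound|]. assert (B := g_bound (n + S k) t).
  split; [eapply Rle_trans; [apply IH|apply Rmax_l]|apply Rmax_lub; lra].
Qed.

Lemma tail_max_incr (n k l : nat) (t : R) : (k <= l)%nat -> tail_max n k t <= tail_max n l t.
Proof.
  induction 1 as [|l _ IH]; [lra|]. simpl. eapply Rle_trans; [exact IH|apply Rmax_l].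
Qed.

Lemma tail_max_shift (n k : nat) (t : R) : tail_max (S n) k t <= tail_max n (S k) t.
Proof.
  induction k as [|k IH].
  - simpl. replace (n + 1)%nat with (S n) by lia. apply Rmax_r.
  - change (tail_max (S n) (S k) t) with (Rmax (tail_max (S n) k t) (g (S n + S k) t)).
    change (tail_max n (S (S k)) t) with (Rmax (tail_max n (S k) t) (g (n + S (S k)) t)).
    replace (n + S (S k))%nat with (S n + S k)%nat by lia.
    apply Rmax_lub; [eapply Rle_trans; [exact IH|apply Rmax_l]|apply Rmax_r].
Qed.

Lemma tail_max_lt (n k : nat) (t e : R) :
  (forall m, (n <= m)%nat -> g m t < e) -> tail_max n k t < e.
Proof.
  intros H. induction k as [|k IH]; simpl; [apply H; lia|]. apply Rmax_lub_lt; [exact IH|apply H; lia].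
Qed.

Lemma RInt_le_cont (u v : R -> R) :
  (forall t, continuous u t) -> (forall t, continuous v t) -> (forall t, u t <= v t) ->
  RInt u a b <= RInt v a b.
Proof.
  intros Hu Hv H. apply (is_RInt_le u v a b); auto; now apply is_RInt_cont.
Qed.

(* Arzela's bounded convergence theorem: replace the sequence by a decreasing one,
   minima of finite tail maxima, losing arbitrarily little of the integral at each step. *)
Lemma arzela (E : R -> Prop) (eps : R) :
  null_set E -> (forall t, ~ E t -> forall e, 0 < e -> exists N, forall n, (N <= n)%nat -> g n t < e) ->
  0 < eps -> exists n, RInt (g n) a b < eps.
Proof.
  intros HE Hlim Heps. apply NNPP. intros Nex.
  assert (Hge : forall n, eps <= RInt (g n) a b).
  { intros n. destruct (Rle_dec eps (RInt (g n) a b)) as [L|L]; [exact L|].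
    exfalso. apply Nex. exists n. lra. }
  (* [I n] replaces the integral of the tail supremum from [n] on. *)
  assert (ExI : forall n, exists I, is_lub (fun x => exists k, x = RInt (tail_max n k) a b) I).
  { intros n. destruct (completeness (fun x => exists k, x = RInt (tail_max n k) a b)) as [I HI].
    - exists (RInt (fun _ => 1) a b). intros x [k ->]. apply RInt_le_cont.
      + apply tail_max_cont.
      + intros t. apply continuous_const.
      + intros t. apply tail_max_bound.
    - exists (RInt (tail_max n 0) a b). now exists 0%nat.
    - now exists I. }
  destruct (choice _ ExI) as [I HI].
  assert (I_ub : forall n k, RInt (tail_max n k) a b <= I n).
  { intros n k. apply (proj1 (HI n)). now exists k. }
  assert (ExM : forall n, exists m, I n - eps / 2 * (/ 2) ^ S n < RInt (tail_max n m) a b).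
  { intros n. apply NNPP. intros N.
    assert (P : 0 < eps / 2 * (/ 2) ^ S n) by (apply Rmult_lt_0_compat; [lra|apply pow_lt; lra]).
    assert (U : I n <= I n - eps / 2 * (/ 2) ^ S n).
    { apply (proj2 (HI n)). intros x [k ->]. apply Rnot_lt_le. intros L. apply N. now exists k. }
    lra. }
  destruct (choice _ ExM) as [m Hm].
  set (kmin := fix kmin (n : nat) (t : R) : R :=
     match n with O => tail_max 0 (m 0%nat) t | S n' => Rmin (kmin n' t) (tail_max (S n') (m (S n')) t) end).
  assert (kS : forall n t, kmin (S n) t = Rmin (kmin n t) (tail_max (S n) (m (S n)) t)) by reflexivity.
  assert (kc : forall n t, continuous (kmin n) t).
  { intros n t. induction n as [|n IH]; [apply (tail_max_cont 0)|].
    apply (continuous_Rmin_fun (kmin n) (tail_max (S n) (m (S n)))); [exact IH|apply tail_max_cont]. }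
  assert (kle : forall n t, kmin n t <= tail_max n (m n) t).
  { intros [|n] t; [simpl; lra|]. rewrite kS. apply Rmin_r. }
  assert (kdec : forall n l t, (n <= l)%nat -> kmin l t <= kmin n t).
  { intros n l t. induction 1 as [|l _ IH]; [lra|]. rewrite kS. eapply Rle_trans; [apply Rmin_l|exact IH]. }
  (* Stage j loses at most eps/2 * 2^-(j+1); the bracket is the sum of these losses up to [n]. *)
  assert (kint : forall n, I n - eps / 2 * (1 - (/ 2) ^ S n) <= RInt (kmin n) a b).
  { induction n as [|n IH].
    - specialize (Hm 0%nat). change (kmin 0%nat) with (tail_max 0 (m 0%nat)). simpl in *. lra.
    - set (h := tail_max (S n) (m (S n))).
      assert (hc : forall t, continuous h t) by (intros t; apply tail_max_cont).
      assert (Mc : forall t, continuous (fun t => Rmax (kmin n t) (h t)) t).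
      { intros t. apply continuous_Rmax_fun; auto. }
      (* From min + max = sum. The maximum is still below a finite tail maximum from [n], so its
         integral is at most [I n], which cancels the [I n] in the bound for [kmin n]. *)
      assert (EQ : RInt (kmin (S n)) a b = RInt (kmin n) a b + RInt h a b - RInt (fun t => Rmax (kmin n t) (h t)) a b).
      { apply is_RInt_unique.
        apply is_RInt_ext with (fun t => minus (plus (kmin n t) (h t)) (Rmax (kmin n t) (h t))).
        - intros t _. rewrite kS. fold h. unfold minus, plus, opp; simpl. unfold Rmin, Rmax, h.
          destruct (Rle_dec _ _); ring.
        - apply (is_RInt_minus (V := R_NormedModule)); [apply (is_RInt_plus (V := R_NormedModule))|]; apply is_RInt_cont; auto. }
      assert (UB : RInt (fun t => Rmax (kmin n t) (h t)) a b <= I n).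
      { eapply Rle_trans; [|apply (I_ub n (Nat.max (m n) (S (m (S n)))))].
        apply RInt_le_cont; [exact Mc|apply tail_max_cont|]. intros t. apply Rmax_lub.
        - eapply Rle_trans; [apply kle|]. apply tail_max_incr. lia.
        - eapply Rle_trans; [apply tail_max_shift|]. apply tail_max_incr. lia. }
      specialize (Hm (S n)). fold h in Hm. rewrite EQ.
      replace ((/ 2) ^ S (S n)) with (/ 2 * (/ 2) ^ S n) in * by reflexivity. nra. }
  assert (klow : forall n, eps / 2 <= RInt (kmin n) a b).
  { intros n. specialize (kint n). assert (K : RInt (g n) a b <= I n) by exact (I_ub n 0%nat).
    specialize (Hge n).
    assert (P : 0 < (/ 2) ^ S n) by (apply pow_lt; lra). nra. }
  (* Dini's bound eta (b - a) + eta becomes eps/4, below the lower bound eps/2 on all the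
     integrals. *)
  set (eta := eps / 4 / (b - a + 1)).
  assert (Peta : 0 < eta) by (apply Rdiv_lt_0_compat; lra).
  destruct (dini_off_null_set kmin E a b eta) as [n Hn]; auto.
  - intros n t. eapply Rle_trans; [apply kle|apply tail_max_bound].
  - intros t Ht e He. destruct (Hlim t Ht e He) as [N HN]. exists N.
    eapply Rle_lt_trans; [apply kle|now apply tail_max_lt].
  - specialize (klow n). replace (eta * (b - a) + eta) with (eps / 4) in Hn by (unfold eta; field; lra). lra.
Qed.
End Arzela.

(** * Inner symbols force the weight to be constant *)

Lemma one_sub_neq_0 (v : C) : Cmod v < 1 -> (1 - v)%C <> RtoC 0.
Proof.
  intros Hv. apply Cmod_gt_neq0. assert (K := Cmod_ge_sub (RtoC 1) v). rewrite Cmod_1 in K. lra.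
Qed.

Lemma Re_div_mul (X Y : C) : Y <> RtoC 0 ->
  Re (X / Y)%C * (Cmod Y * Cmod Y) = Re (X * Cconj Y)%C.
Proof.
  intros HY.
  assert (E : (X * Cconj Y)%C = (RtoC (Cmod Y * Cmod Y) * (X / Y))%C).
  { replace (RtoC (Cmod Y * Cmod Y)) with (Y * Cconj Y)%C.
    - field. exact HY.
    - rewrite Cmod_sqr. destruct Y as [y1 y2]. unfold Cmult, Cconj, RtoC, Re, Im; simpl. f_equal; ring. }
  rewrite E. unfold Re at 2. simpl. unfold Re. ring.
Qed.

Lemma Re_div_pos (X Y : C) : Y <> RtoC 0 -> (0 < Re (X / Y)%C <-> 0 < Re (X * Cconj Y)%C).
Proof.
  intros HY. rewrite <- Re_div_mul by exact HY.
  assert (P : 0 < Cmod Y * Cmod Y) by (apply Cmod_gt_0 in HY; nra).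
  split; intros H; [now apply Rmult_lt_0_compat|].
  apply Rmult_lt_reg_r with (Cmod Y * Cmod Y); [exact P|]. lra.
Qed.

Lemma inP_ell_rotation (lam : C) : Cmod lam = 1 -> inP (fun w => ell (lam * w)%C).
Proof.
  intros Hl.
  assert (B : forall w, inD w -> Cmod (lam * w)%C < 1) by (intros w Hw; rewrite Cmod_mult, Hl; unfold inD in Hw; lra).
  split; [|split].
  - intros w Hw. apply cdiff_ex_derive. unfold ell.
    apply cdiff_div; [now apply one_sub_neq_0, B|apply cdiff_plus|apply cdiff_minus];
      try apply cdiff_const; apply cdiff_scal, cdiff_id.
  - intros w Hw. unfold ell. specialize (B w Hw). set (v := (lam * w)%C) in *.
    apply Re_div_pos; [now apply one_sub_neq_0|].
    assert (S := Cmod_sqr v). assert (P := Cmod_ge_0 v).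
    destruct v as [v1 v2]. unfold Re, Im in *; simpl in *. nra.
  - unfold ell. replace (lam * 0)%C with (RtoC 0) by ring. field.
Qed.

(** Since (1 + x)(1 - conj x) = 1 - |x|^2 + 2i Im x, the product of two such factors has real part
    (1 - |x|^2)(1 - |y|^2) - 4 Im x Im y. *)
Lemma Re_ell_mul_pos (x y : C) : Cmod x < 1 -> Cmod y < 1 -> 0 < Re (ell x * ell y)%C ->
  4 * (Im x * Im y) < (1 - Cmod x * Cmod x) * (1 - Cmod y * Cmod y).
Proof.
  intros Hx Hy H. assert (Nx := one_sub_neq_0 x Hx). assert (Ny := one_sub_neq_0 y Hy).
  unfold ell in H.
  replace ((1 + x) / (1 - x) * ((1 + y) / (1 - y)))%C with
    (((1 + x) * (1 + y)) / ((1 - x) * (1 - y)))%C in H by (field; auto).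
  apply (Re_div_pos _ _ (Cmult_neq_0 _ _ Nx Ny)) in H.
  rewrite !Cmod_sqr. destruct x as [x1 x2], y as [y1 y2]. unfold Re, Im in *; simpl in *.
  match type of H with 0 < ?e => replace e with
    ((1 - (x1 * x1 + x2 * x2)) * (1 - (y1 * y1 + y2 * y2)) - 4 * (x2 * y2)) in H by ring end.
  lra.
Qed.

Lemma Im_weight_bound (phi omega : C -> C) (z : C) :
  schwarz_type phi -> schwarz_type omega ->
  (forall f, inP f -> inP (T_op (fun z => ell (omega z)) phi f)) -> inD z ->
  4 * Cmod (phi z) * Rabs (Im (omega z)) <= 1 - Cmod (phi z) * Cmod (phi z).
Proof.
  intros Hphi Homega HT Hz.
  assert (Hp : Cmod (phi z) < 1) by now apply Hphi. assert (Ho : Cmod (omega z) < 1) by now apply Homega.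
  assert (Pp := Cmod_ge_0 (phi z)). assert (Po := Cmod_ge_0 (omega z)).
  destruct (classic (phi z = RtoC 0)) as [E|N].
  { rewrite E, Cmod_0. lra. }
  apply Cmod_gt_0 in N. set (rho := Cmod (phi z)) in *.
  assert (N' : phi z <> RtoC 0) by now apply Cmod_gt_0.
  (* Both signs s = 1 and s = -1 are used, to reach the absolute value; the factor 1 - |omega z|^2
     on the right is bounded by 1. *)
  assert (Key : forall s, s * s = 1 -> 4 * (Im (omega z) * (s * rho)) <= 1 - rho * rho).
  { intros s Hs. set (v := (0, s * rho) : C).
    assert (Hv : Cmod v = rho).
    { assert (E := Cmod_sqr v). assert (P := Cmod_ge_0 v). unfold v in E at 3 4; simpl in E. nra. }
    set (lam := (v / phi z)%C).
    assert (Hl : Cmod lam = 1) by (unfold lam; rewrite Cmod_div, Hv by exact N'; unfold rho; field; unfold rho in N; lra).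
    assert (K := proj1 (proj2 (HT _ (inP_ell_rotation lam Hl))) z Hz). unfold T_op in K.
    replace (lam * phi z)%C with v in K by (unfold lam; field; exact N').
    apply Re_ell_mul_pos in K; [|exact Ho|lra]. rewrite Hv in K.
    change (Im v) with (s * rho) in K.
    assert (0 <= Cmod (omega z) * Cmod (omega z) <= 1) by nra. assert (0 <= 1 - rho * rho) by nra. nra. }
  assert (K1 := Key 1 ltac:(lra)). assert (K2 := Key (-1) ltac:(lra)).
  unfold Rabs. destruct (Rcase_abs (Im (omega z))); lra.
Qed.

(** Arzela's theorem takes a sequence, so the radial limit is sampled along these radii; the shift
    by 2 keeps them at least 1/2. *)
Definition radius (n : nat) : R := 1 - / (INR n + 1 + 1).

Lemma radius_bounds (n : nat) : 1 / 2 <= radius n < 1.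
Proof.
  unfold radius. assert (P := pos_INR n).
  assert (0 < / (INR n + 1 + 1)) by (apply Rinv_0_lt_compat; lra).
  assert (/ (INR n + 1 + 1) <= / 2) by (apply Rinv_le_contravar; lra). lra.
Qed.

Lemma radius_cvg (d : R) : 0 < d -> exists N, forall n, (N <= n)%nat -> 1 - radius n < d.
Proof.
  intros Hd. destruct (inv_INR_small d Hd) as [N HN]. exists N. intros n Hn.
  specialize (HN (S n) ltac:(lia)). rewrite S_INR in HN. unfold radius. lra.
Qed.

Lemma Im_vanishes_radially (phi omega : C -> C) (t : R) (L : C) :
  (forall z, inD z -> 4 * Cmod (phi z) * Rabs (Im (omega z)) <= 1 - Cmod (phi z) * Cmod (phi z)) ->
  (forall z, inD z -> Cmod (phi z) <= 1) ->
  radial_limit phi t L -> Cmod L = 1 ->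
  forall e, 0 < e -> exists N, forall n, (N <= n)%nat -> Im (omega (circ (radius n) t)) ^ 2 < e.
Proof.
  intros HB Hphi HL HL1 e He.
  assert (HLt := tends_filterlim (at_left 1) _ L HL).
  (* With |phi| >= 1 - d >= 1/2 the bound yields 2 |Im omega| <= (1 - |phi|)(1 + |phi|) <= 2 d, and
     d^2 <= e/4. *)
  set (d := Rmin (1 / 2) (e / 2)). assert (Hd : 0 < d) by (apply Rmin_pos; lra).
  assert (Hd1 : d <= 1 / 2) by apply Rmin_l. assert (Hd2 : d <= e / 2) by apply Rmin_r.
  destruct (HLt d Hd) as [del Hdel].
  destruct (radius_cvg del (cond_pos del)) as [N HN]. exists N. intros n Hn.
  specialize (HN n Hn). assert (B := radius_bounds n).
  assert (Hin : inD (circ (radius n) t)) by (unfold inD; rewrite Cmod_circ; lra).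
  assert (K : Cmod (phi (circ (radius n) t) - L)%C < d).
  { apply (Hdel (radius n)); [|lra].
    change (Rabs (radius n - 1) < del). rewrite Rabs_minus_sym, Rabs_pos_eq; lra. }
  specialize (HB _ Hin). specialize (Hphi _ Hin).
  set (w := circ (radius n) t) in *.
  assert (K1 := Cmod_ge_sub L (phi w)). rewrite Cmod_sub_sym in K1.
  set (rho := Cmod (phi w)) in *. set (y := Im (omega w)) in *.
  assert (Py := Rabs_pos y).
  assert (Hy : Rabs y <= d).
  { assert (1 - rho < d) by lra. assert (1 / 2 <= rho) by lra. nra. }
  rewrite <- (pow2_abs y). nra.
Qed.

(** Cauchy's formula for omega^2 at [z] transfers the smallness of the circular means to the point:
    2 pi |omega z|^2 is at most 2 / (1 - |z|) times the integral of |omega|^2, which equals twice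
    that of (Im omega)^2. *)
Lemma inner_weight_vanishes (phi omega : C -> C) (z : C) :
  schwarz_type omega -> is_inner phi ->
  (forall z, inD z -> 4 * Cmod (phi z) * Rabs (Im (omega z)) <= 1 - Cmod (phi z) * Cmod (phi z)) ->
  inD z -> omega z = RtoC 0.
Proof.
  intros [Oa [Ob O0]] [_ [Hp1 Hnull]] HB Hz. apply NNPP. intros N. apply Cmod_gt_0 in N.
  assert (HP := PI_RGT_0). assert (Pz := Cmod_ge_0 z). unfold inD in Hz.
  assert (Od : forall w, inD w -> cdiff omega w) by (intros w Hw; apply ex_derive_cdiff, Oa, Hw).
  assert (Hin : forall n t, inD (circ (radius n) t)).
  { intros n t. assert (B := radius_bounds n). unfold inD. rewrite Cmod_circ; lra. }
  set (g := fun n t => Im (omega (circ (radius n) t)) ^ 2).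
  assert (gc : forall n t, continuous (g n) t).
  { intros n t.
    assert (Hc : rcont (fun t => omega (circ (radius n) t)) t) by (apply rcont_comp; [apply Od, Hin|apply rcont_circ]).
    apply rcont_Im in Hc. unfold g.
    apply continuous_ext with (fun t => mult (Im (omega (circ (radius n) t))) (Im (omega (circ (radius n) t)))).
    - intros u. unfold mult; simpl. ring.
    - apply (continuous_mult (K := R_AbsRing)); exact Hc. }
  assert (gb : forall n t, 0 <= g n t <= 1).
  { intros n t. unfold g. specialize (Ob _ (Hin n t)). unfold inD in Ob.
    assert (B := abs_Im_le (omega (circ (radius n) t))). rewrite <- pow2_abs.
    assert (P := Rabs_pos (Im (omega (circ (radius n) t)))). nra. }
  destruct (radius_cvg ((1 - Cmod z) / 2) ltac:(lra)) as [N0 HN0].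
  (* The least value that this estimate allows for the integral of (Im omega)^2, so an integral
     below it is contradictory. *)
  set (eps := PI * (Cmod (omega z) * Cmod (omega z)) * ((1 - Cmod z) / 2)).
  assert (Peps : 0 < eps)
    by (apply Rmult_lt_0_compat; [apply Rmult_lt_0_compat; [lra|nra]|lra]).
  (* [arzela] returns a single index without control on its size. Shifting by [N0] forces rho - |z|
     > (1 - |z|) / 2, which makes the kernel at most 2 / (1 - |z|). *)
  destruct (arzela (fun n => g (N0 + n)%nat) 0 (2 * PI) ltac:(lra) (fun n => gc _) (fun n => gb _)
             _ eps Hnull) as [n Hn]; [|exact Peps|].
  { intros t Ht e He. apply NNPP in Ht. destruct Ht as [L [HL HL1]].
    destruct (Im_vanishes_radially phi omega t L HB Hp1 HL HL1 e He) as [N1 HN1].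
    exists N1. intros n Hn. apply HN1. lia. }
  specialize (HN0 (N0 + n)%nat ltac:(lia)). set (m := (N0 + n)%nat) in *.
  assert (Bm := radius_bounds m). set (rho := radius m) in *.
  assert (Hd2 : forall w, Cmod w <= rho -> cdiff (fun w => omega w * omega w)%C w).
  { intros w Hw. apply cdiff_mult; apply Od; unfold inD; lra. }
  (* [|w|^2 = Re (w^2) + 2 (Im w)^2], and [Re (omega^2)] has mean [Re (omega(0)^2) = 0]. *)
  assert (Q : is_RInt (fun t => 2 / (1 - Cmod z) * (Cmod (omega (circ rho t)) * Cmod (omega (circ rho t))))
                0 (2 * PI) (2 / (1 - Cmod z) * (2 * RInt (g m) 0 (2 * PI)))).
  { assert (M := proj1 (mean_value (fun w => omega w * omega w)%C rho ltac:(lra) Hd2)).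
    cbv beta in M. rewrite O0 in M.
    replace (Re (RtoC (2 * PI) * (RtoC 0 * RtoC 0))%C) with 0 in M by (unfold Re; simpl; ring).
    apply is_RInt_ext with (fun t => scal (2 / (1 - Cmod z)) (plus (Re (omega (circ rho t) * omega (circ rho t))%C) (scal 2 (g m t)))).
    - intros t _. unfold scal, plus; simpl. unfold mult; simpl. rewrite Cmod_sqr.
      unfold g. fold rho. unfold Re, Im; simpl. ring.
    - apply (is_RInt_scal (V := R_NormedModule)).
      replace (2 * RInt (g m) 0 (2 * PI)) with (plus 0 (scal 2 (RInt (g m) 0 (2 * PI)))).
      + apply (is_RInt_plus (V := R_NormedModule)); [exact M|].
        apply (is_RInt_scal (V := R_NormedModule)), is_RInt_cont, gc.
      + unfold scal, plus; simpl. unfold mult; simpl. ring. }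
  assert (Cf := cauchy_formula (fun w => omega w * omega w)%C rho z ltac:(lra) Hd2).
  assert (H2pi : 0 <= 2 * PI) by lra.
  assert (Nb := fun h => is_CI_norm_le _ _ 0 (2 * PI) _ _ H2pi h Cf Q). clear Cf.
  match type of Nb with ?h -> _ => assert (Hb : h) end.
  { intros t _. rewrite !Cmod_mult. apply Rmult_le_compat_r.
    + apply Rmult_le_pos; apply Cmod_ge_0.
    + eapply Rle_trans; [apply Cmod_ckern_le; lra|].
      replace (2 / (1 - Cmod z)) with (1 * / ((1 - Cmod z) / 2)) by (field; lra).
      apply Rmult_le_compat; [lra|apply Rlt_le, Rinv_0_lt_compat; lra|lra|].
      apply Rinv_le_contravar; lra. }
  specialize (Nb Hb).
  rewrite !Cmod_mult, Cmod_R, Rabs_pos_eq in Nb by lra.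
  assert (Cf2 : 2 * PI * (Cmod (omega z) * Cmod (omega z)) * ((1 - Cmod z) / 2)
           <= 2 / (1 - Cmod z) * (2 * RInt (g m) 0 (2 * PI)) * ((1 - Cmod z) / 2)).
  { apply Rmult_le_compat_r; lra. }
  replace (2 / (1 - Cmod z) * (2 * RInt (g m) 0 (2 * PI)) * ((1 - Cmod z) / 2))
    with (2 * RInt (g m) 0 (2 * PI)) in Cf2 by (field; lra).
  unfold eps in Hn. lra.
Qed.

Theorem theorem4p1 (phi omega : C -> C)
  (Hphi : schwarz_type phi) (Homega : schwarz_type omega)
  (HT : forall f, inP f -> inP (T_op (fun z => ell (omega z)) phi f))
  (Hrot : ~ is_rotation phi) :
  (exists G : C -> C,
     inP G /\ is_fixed (fun z => ell (omega z)) phi G /\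
     (forall H : C -> C, inP H -> is_fixed (fun z => ell (omega z)) phi H ->
        forall z, inD z -> H z = G z) /\
     (forall f, inP f ->
        cvg_locally_uniformly_D
          (fun n => T_iter (fun z => ell (omega z)) phi n f) G)) /\
  (is_inner phi ->
     forall G : C -> C, inP G -> is_fixed (fun z => ell (omega z)) phi G ->
       forall z, inD z -> G z = RtoC 1).
Proof.
  destruct (T_iter_attracting_fixed_point _ phi Hphi Hrot HT) as [G [GP [GF Conv]]].
  assert (Uniq : forall H : C -> C, inP H -> is_fixed (fun z => ell (omega z)) phi H ->
        forall z, inD z -> H z = G z).
  (* The orbit of a fixed point is constant on the disk, yet it converges to [G]. *)
  { intros H HP HF z Hz. apply eq_of_eventually_close. intros eps He.
    assert (P := Cmod_ge_0 z). unfold inD in Hz.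
    destruct (Conv (Cmod z) ltac:(lra) eps He H HP) as [N HN].
    specialize (HN N (le_n N) z ltac:(lra)).
    rewrite (T_iter_fixed _ phi Hphi H N z HF Hz) in HN. lra. }
  split.
  - exists G. split; [exact GP|]. split; [exact GF|]. split; [exact Uniq|].
    intros f Hf K HK HKD eps He.
    destruct (compact_in_smaller_disk K HK HKD) as [r [Hr Hrb]].
    destruct (Conv r Hr eps He f Hf) as [N HN]. exists N. intros n Hn z Hz. apply HN; auto.
  - intros Hin H HP HF z Hz. rewrite (Uniq H HP HF z Hz). symmetry.
    apply (Uniq (fun _ => RtoC 1)); [apply inP_one| |exact Hz].
    intros w Hw. unfold T_op.
    rewrite (inner_weight_vanishes phi omega w Homega Hin); [|intros; now apply Im_weight_bound|exact Hw].
    unfold ell. field.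
Qed.
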